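(* Let $(A,X)$ be a primitive axial algebra of Jordan type $\tfrac12$ over a field $\mathbb{F}$ with $\operatorname{char}\mathbb{F}\neq 2$. For every $a,b\in X$ with $a\neq b$, the subalgebra $\langle\!\langle a,b\rangle\!\rangle$ of $A$ generated by $a$ and $b$ is solid if and only if the associator $[L_a,L_b]\colon A\to A$, $x\mapsto a(bx)-b(ax)$, is a derivation of $A$.
   Context: Algebras are commutative but not necessarily associative. For an algebra $A$ over a field $\mathbb{F}$ ($\operatorname{char}\mathbb{F}\ne2$), $a\in A$ and $\lambda\in\mathbb{F}$, let $L_a(x)=ax$ and $A_\lambda(a)=\{x\in A: ax=\lambda x\}$. A nonzero idempotent $a\in A$ is a $\mathcal{J}(\tfrac12)$-axis if $A=A_1(a)\oplus A_0(a)\oplus A_{1/2}(a)$ and $A_1(a)A_1(a)\subseteq A_1(a)$, $A_0(a)A_0(a)\subseteq A_0(a)$, $A_1(a)A_0(a)=0$, $A_1(a)A_{1/2}(a)\subseteq A_{1/2}(a)$, $A_0(a)A_{1/2}(a)\subseteq A_{1/2}(a)$, $A_{1/2}(a)A_{1/2}(a)\subseteq A_1(a)\oplus A_0(a)$. It is primitive if $A_1(a)=\mathbb{F}a$. A primitive axial algebra of Jordan type $\tfrac12$ is a pair $(A,X)$ where $X\subset A$ is a set of primitive $\mathcal{J}(\tfrac12)$-axes generating $A$ as an algebra. A primitive idempotent of an algebra $B$ over a field $\mathbb{K}$ is a nonzero idempotent $c\in B$ with $\{x\in B: cx=x\}=\mathbb{K}c$. For $a\neq b$ in $X$, the subalgebra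 $B=\langle\!\langle a,b\rangle\!\rangle$ is solid if, for an (equivalently every) algebraic closure $\mathbb{E}$ of $\mathbb{F}$, every primitive idempotent of $B\otimes_{\mathbb{F}}\mathbb{E}$ is a $\mathcal{J}(\tfrac12)$-axis of $A\otimes_{\mathbb{F}}\mathbb{E}$. *)

(* Defs.v *)
From HB Require Import structures.
From mathcomp Require Import all_boot all_order all_algebra generic_quotient.
From mathcomp Require Import boolp classical_sets.

Set Implicit Arguments.
Unset Strict Implicit.
Unset Printing Implicit Defensive.

Import GRing.Theory.

Local Open Scope classical_set_scope.
Local Open Scope ring_scope.
Local Open Scope quotient_scope.

Reserved Notation "x ** y" (at level 40, left associativity).

(* Commutative algebras, not assumed associative, unital or
   finite-dimensional. *)
HB.mixin Record Lmodule_isComNAAlg (F : fieldType) A of GRing.Lmodule F A := {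
  amul : A -> A -> A;
  amulC : commutative amul;
  amulDl : left_distributive amul +%R;
  amulZl : forall (k : F) x y, amul (k *: x) y = k *: amul x y
}.

#[short(type="comNAAlgType")]
HB.structure Definition ComNAAlg (F : fieldType) :=
  {A of GRing.Lmodule F A & Lmodule_isComNAAlg F A}.

Notation "x ** y" := (amul x y) : ring_scope.

Section AlgebraTheory.
Context {F : fieldType} {A : comNAAlgType F}.
Implicit Types (x y z : A) (k : F).

Lemma amulDr x y z : x ** (y + z) = x ** y + x ** z.
Proof. by rewrite amulC amulDl !(amulC x). Qed.

Lemma amulZr k x y : x ** (k *: y) = k *: (x ** y).
Proof. by rewrite amulC amulZl (amulC x). Qed.

Lemma amul_is_linear x : linear (amul x).
Proof. by move=> k y z; rewrite amulDr amulZr. Qed.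

HB.instance Definition _ x :=
  GRing.isLinear.Build F A A _ (amul x) (amul_is_linear x).

End AlgebraTheory.

Section Axes.
Context {F : fieldType} {A : comNAAlgType F}.

Definition eigen (a : A) (l : F) : set A := [set x | a ** x = l *: x].

Definition prodset (U V : set A) : set A := [set x ** y | x in U & y in V].

Definition sumset (U V : set A) : set A := [set x + y | x in U & y in V].

Definition nz_idempotent (a : A) : Prop := a != 0 /\ a ** a = a.

Definition peirce_decomposition (a : A) : Prop :=
  forall x : A, exists! p : A * A * A,
    [/\ eigen a 1 p.1.1, eigen a 0 p.1.2, eigen a 2^-1 p.2
      & x = p.1.1 + p.1.2 + p.2].

Record jordan_fusion (a : A) : Prop := JordanFusion {
  fusion11 : prodset (eigen a 1) (eigen a 1) `<=` eigen a 1;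
  fusion00 : prodset (eigen a 0) (eigen a 0) `<=` eigen a 0;
  fusion10 : prodset (eigen a 1) (eigen a 0) `<=` [set 0];
  fusion1h : prodset (eigen a 1) (eigen a 2^-1) `<=` eigen a 2^-1;
  fusion0h : prodset (eigen a 0) (eigen a 2^-1) `<=` eigen a 2^-1;
  fusionhh : prodset (eigen a 2^-1) (eigen a 2^-1)
               `<=` sumset (eigen a 1) (eigen a 0)
}.

Definition jhalf_axis (a : A) : Prop :=
  [/\ nz_idempotent a, peirce_decomposition a & jordan_fusion a].

Definition line (a : A) : set A := range (fun k : F => k *: a).

Definition primitive_jhalf_axis (a : A) : Prop :=
  jhalf_axis a /\ eigen a 1 = line a.

Definition is_subalgebra (S : set A) : Prop :=
  [/\ S 0, forall x y, S x -> S y -> S (x + y),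
      forall (k : F) x, S x -> S (k *: x)
    & forall x y, S x -> S y -> S (x ** y)].

Definition gen_subalgebra (X : set A) : set A := smallest is_subalgebra X.

Definition primitive_axial_jhalf (X : set A) : Prop :=
  (forall a, X a -> primitive_jhalf_axis a) /\ gen_subalgebra X = setT.

Definition primitive_idempotent_in (B : set A) (c : A) : Prop :=
  [/\ B c, nz_idempotent c & B `&` eigen c 1 = line c].

Definition associator (a b : A) : A -> A :=
  fun x => a ** (b ** x) - b ** (a ** x).

Definition derivation (D : A -> A) : Prop :=
  linear D /\ forall x y, D (x ** y) = D x ** y + x ** D y.

End Axes.

(* The scalar extension A (x)_F E along iota : F -> E. A list of pairs (x, e)
   stands for the sum of the x (x) e; two lists are identified when every
   F-linear map from A to every E-vector space W gives them the same value.
   The universal property is proved below (extend_linear, extendE and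
   extend_unique). *)
Section ScalarExtension.
Context {F E : fieldType} (iota : {rmorphism F -> E}) (A : lmodType F).

Definition ext_linear (W : lmodType E) (f : A -> W) : Prop :=
  linear_for (iota \; *:%R) f.

Definition teval (W : lmodType E) (f : A -> W) (s : seq (A * E)) : W :=
  \sum_(p <- s) p.2 *: f p.1.

Definition teq (s t : seq (A * E)) : bool :=
  `[< forall (W : lmodType E) (f : A -> W), ext_linear f ->
        teval f s = teval f t >].

Lemma teqP s t :
  reflect (forall (W : lmodType E) (f : A -> W), ext_linear f ->
             teval f s = teval f t) (teq s t).
Proof. exact: asboolP. Qed.

Lemma teq_refl : reflexive teq.
Proof. by move=> s; apply/teqP. Qed.

Lemma teq_sym : symmetric teq.
Proof.
by move=> s t; apply/teqP/teqP => st W f lf; rewrite (st W f lf).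
Qed.

Lemma teq_trans : transitive teq.
Proof.
move=> t s u /teqP st /teqP tu; apply/teqP => W f lf.
by rewrite (st W f lf) (tu W f lf).
Qed.

Canonical teq_equiv := EquivRel teq teq_refl teq_sym teq_trans.

Definition scalext : Type := {eq_quot teq}.

HB.instance Definition _ := Choice.on scalext.
HB.instance Definition _ := EqQuotient.on scalext.

Definition pure (x : A) (e : E) : scalext := \pi_scalext [:: (x, e)].

Definition extend (W : lmodType E) (f : A -> W) (u : scalext) : W :=
  teval f (repr u).

Lemma scalext_eqP s t :
  reflect (forall (W : lmodType E) (f : A -> W), ext_linear f ->
             teval f s = teval f t)
          (\pi_scalext s == \pi_scalext t).
Proof. by rewrite piE; apply: teqP. Qed.

Lemma extend_pi (W : lmodType E) (f : A -> W) s :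
  ext_linear f -> extend f (\pi_scalext s) = teval f s.
Proof. by move=> lf; apply: (elimT (scalext_eqP _ _)) lf; rewrite reprK. Qed.

Lemma extend_inj (u v : scalext) :
  (forall (W : lmodType E) (f : A -> W), ext_linear f ->
     extend f u = extend f v) -> u = v.
Proof.
move=> uv; rewrite -[u]reprK -[v]reprK; apply/eqP/scalext_eqP => W f lf.
exact: uv.
Qed.

Definition tscale_seq (k : E) (s : seq (A * E)) := [seq (p.1, k * p.2) | p <- s].

Definition text0 : scalext := \pi_scalext [::].
Definition text_add (u v : scalext) : scalext :=
  \pi_scalext (repr u ++ repr v).
Definition text_scale (k : E) (u : scalext) : scalext :=
  \pi_scalext (tscale_seq k (repr u)).
Definition text_opp (u : scalext) : scalext := text_scale (-1) u.

Lemma teval_cat (W : lmodType E) (f : A -> W) s t :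
  teval f (s ++ t) = teval f s + teval f t.
Proof. exact: big_cat. Qed.

Lemma teval_scale (W : lmodType E) (f : A -> W) k s :
  teval f (tscale_seq k s) = k *: teval f s.
Proof.
rewrite /teval big_map scaler_sumr.
by apply: eq_bigr => p _; rewrite scalerA.
Qed.

Section ExtendOps.
Context (W : lmodType E) (f : A -> W) (lf : ext_linear f).

Lemma extend0 : extend f text0 = 0.
Proof. by rewrite extend_pi // /teval big_nil. Qed.

Lemma extendD u v : extend f (text_add u v) = extend f u + extend f v.
Proof. by rewrite extend_pi // teval_cat. Qed.

Lemma extendZ k u : extend f (text_scale k u) = k *: extend f u.
Proof. by rewrite extend_pi // teval_scale. Qed.

Lemma extendN u : extend f (text_opp u) = - extend f u.
Proof. by rewrite extendZ scaleN1r. Qed.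

End ExtendOps.

Lemma text_addA : associative text_add.
Proof. by move=> u v w; apply: extend_inj => W f lf; rewrite !extendD // addrA. Qed.

Lemma text_addC : commutative text_add.
Proof. by move=> u v; apply: extend_inj => W f lf; rewrite !extendD // addrC. Qed.

Lemma text_add0 : left_id text0 text_add.
Proof. by move=> u; apply: extend_inj => W f lf; rewrite extendD // extend0 // add0r. Qed.

Lemma text_addN : left_inverse text0 text_opp text_add.
Proof.
move=> u; apply: extend_inj => W f lf.
by rewrite extendD // extendN // extend0 // addNr.
Qed.

HB.instance Definition _ := GRing.isZmodule.Build scalext
  text_addA text_addC text_add0 text_addN.

Lemma text_scaleA (j k : E) (u : scalext) :
  text_scale j (text_scale k u) = text_scale (j * k) u.
Proof. by apply: extend_inj => W f lf; rewrite !extendZ // scalerA. Qed.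

Lemma text_scale1 : left_id 1 text_scale.
Proof. by move=> u; apply: extend_inj => W f lf; rewrite extendZ // scale1r. Qed.

Lemma text_scaleDr : right_distributive text_scale +%R.
Proof.
move=> k u v; apply: extend_inj => W f lf.
by rewrite [LHS]extendZ // !extendD // !extendZ // scalerDr.
Qed.

Lemma text_scaleDl (u : scalext) :
  {morph text_scale^~ u : j k / j + k}.
Proof.
move=> j k; apply: extend_inj => W f lf.
by rewrite [LHS]extendZ // !extendD // !extendZ // scalerDl.
Qed.

HB.instance Definition _ := GRing.Zmodule_isLmodule.Build E scalext
  text_scaleA text_scale1 text_scaleDr text_scaleDl.

Lemma extend_linear (W : lmodType E) (f : A -> W) :
  ext_linear f -> linear (extend f : scalext -> W).
Proof. by move=> lf k u v; rewrite [LHS]extendD // extendZ. Qed.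

Lemma pure1_ext_linear : ext_linear (pure^~ 1 : A -> scalext).
Proof.
move=> k x y; apply: extend_inj => W f lf.
rewrite [RHS]extendD // /= [extend f (iota k *: _)]extendZ //.
by rewrite !extend_pi // /teval !big_seq1 /= !scale1r lf.
Qed.

Lemma scale_pure (k e : E) (x : A) : k *: pure x e = pure x (k * e).
Proof.
apply: extend_inj => W f lf; rewrite [LHS]extendZ //.
by rewrite !extend_pi // /teval !big_seq1 /= scalerA.
Qed.

Lemma extendE (W : lmodType E) (f : A -> W) x e :
  ext_linear f -> extend f (pure x e) = e *: f x.
Proof. by move=> lf; rewrite extend_pi // /teval big_seq1. Qed.

Lemma pi_sum_pure (s : seq (A * E)) :
  \pi_scalext s = \sum_(p <- s) pure p.1 p.2.
Proof.
elim: s => [|p s IHs]; first by rewrite big_nil.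
rewrite big_cons -IHs; apply: extend_inj => W f lf.
rewrite [RHS]extendD // extendE // !extend_pi //.
by rewrite /teval big_cons.
Qed.

Lemma scalext_sum_pure (u : scalext) :
  u = \sum_(p <- (repr u : seq (A * E))) pure p.1 p.2.
Proof. by rewrite -pi_sum_pure reprK. Qed.

Lemma extend_unique (W : lmodType E) (f : A -> W) (g : scalext -> W) :
    ext_linear f -> linear g -> (forall x, g (pure x 1) = f x) ->
  g =1 extend f.
Proof.
move=> lf lg gf u.
pose G : {linear scalext -> W} :=
  HB.pack g (GRing.isLinear.Build _ _ _ _ g lg).
rewrite {1}[u]scalext_sum_pure -[g]/(G : _ -> _) linear_sum.
apply: eq_bigr => p _.
by rewrite -[p.2 in LHS]mulr1 -scale_pure linearZ /= gf.
Qed.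

End ScalarExtension.

(* The product is (x (x) d) ** (y (x) e) = (x ** y) (x) (d * e); see
   amul_pure. *)
Section ScalarExtensionAlgebra.
Context {F E : fieldType} (iota : {rmorphism F -> E}) (A : comNAAlgType F).
Local Notation AE := (scalext iota A).

Definition tmul_seq (s t : seq (A * E)) : seq (A * E) :=
  [seq (p.1 ** q.1, p.2 * q.2) | p <- s, q <- t].

Definition text_mul (u v : AE) : AE := \pi_AE (tmul_seq (repr u) (repr v)).

Lemma teval_mul (W : lmodType E) (f : A -> W) s t :
  teval f (tmul_seq s t) = teval (fun x => teval (fun y => f (x ** y)) t) s.
Proof.
rewrite /teval big_allpairs_dep; apply: eq_bigr => p _.
by rewrite scaler_sumr; apply: eq_bigr => q _; rewrite scalerA.
Qed.

Lemma teval_mulC (W : lmodType E) (f : A -> W) s t :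
  teval f (tmul_seq s t) = teval f (tmul_seq t s).
Proof.
rewrite /teval !big_allpairs_dep exchange_big; apply: eq_bigr => q _.
by apply: eq_bigr => p _ /=; rewrite amulC mulrC.
Qed.

Lemma ext_linear_mul (W : lmodType E) (f : A -> W) t :
  ext_linear iota f -> ext_linear iota (fun x => teval (fun y => f (x ** y)) t).
Proof.
move=> lf k x x'; rewrite /teval /= scaler_sumr -big_split.
apply: eq_bigr => p _ /=.
by rewrite amulDl amulZl lf /= scalerDr !scalerA mulrC.
Qed.

Lemma extend_mul (W : lmodType E) (f : A -> W) (u v : AE) :
  ext_linear iota f ->
  extend f (text_mul u v) = extend (fun x => extend (fun y => f (x ** y)) v) u.
Proof. by move=> lf; rewrite extend_pi // teval_mul. Qed.

Lemma text_mulC : commutative text_mul.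
Proof.
move=> u v; apply: extend_inj => W f lf.
by rewrite !extend_pi // teval_mulC.
Qed.

Lemma text_mulDl : left_distributive text_mul +%R.
Proof.
move=> u v w; apply: extend_inj => W f lf.
have lg := ext_linear_mul (repr w) lf.
by rewrite extend_mul // [LHS]extendD // [RHS]extendD // !extend_mul.
Qed.

Lemma text_mulZl (k : E) (u v : AE) :
  text_mul (k *: u) v = k *: text_mul u v.
Proof.
apply: extend_inj => W f lf.
have lg := ext_linear_mul (repr v) lf.
by rewrite extend_mul // [LHS]extendZ // [RHS]extendZ // !extend_mul.
Qed.

HB.instance Definition _ := Lmodule_isComNAAlg.Build E AE
  text_mulC text_mulDl text_mulZl.

Lemma amul_pure (x y : A) (d e : E) :
  (pure iota x d : AE) ** pure iota y e = pure iota (x ** y) (d * e).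
Proof.
apply: extend_inj => W f lf; rewrite [LHS]extend_mul // extendE; last first.
  exact: ext_linear_mul.
rewrite extendE ?extendE ?scalerA // => k z z'.
by rewrite amulDr amulZr lf.
Qed.

(* Since E is flat over F, B (x) E embeds in A (x) E for every subspace B of
   A; it is identified with its image. *)
Definition ext_subspace (B : set A) : set AE :=
  [set u | exists s : seq (A * E),
     (forall p, p \in s -> B p.1) /\ u = \sum_(p <- s) pure iota p.1 p.2].

(* Meant for the case where iota : F -> E is an algebraic closure
   (is_algebraic_closure below). *)
Definition solid (a b : A) : Prop :=
  forall c : AE,
    primitive_idempotent_in (ext_subspace (gen_subalgebra [set a; b])) c ->
    jhalf_axis c.

End ScalarExtensionAlgebra.

Definition is_algebraic_closure (F : fieldType) (E : closedFieldType)
    (iota : {rmorphism F -> E}) : Prop :=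
  forall z : E, algebraicOver iota z.

(* Main.v *)
(* Write [b = phi a + h + b0] with [h] in [A_{1/2}(a)] and [b0] in [A_0(a)].
   Since [b] is a primitive axis, [a, h, b0] span the subalgebra and their
   products depend on [phi] alone; with [q = phi (1 - phi)], the idempotents
   [n(t)/N(t)], where [n(t) = a + t h + phi t^2 b0] and [N(t) = 1 + q t^2],
   together with a similar curve through [b0 / (1 - phi)], are all the primitive
   ones when [h <> 0].  That [n/N] is an axis amounts to polynomial identities
   in [t] of degree at most 8.

   If every [n(t)/N(t)] is an axis, its Miyamoto involution is an automorphism
   for every [t], and differentiating at [t = 0] shows that [[L_a, L_b]] is a
   derivation.  Conversely a derivation [D = [L_a, L_b]] satisfies
   [4 D n = N' n - N n'], so it acts on the identities as the vector field
   [- N d/dt / 4]: as 2 is invertible, an identity that holds at a parameter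
   with [N <> 0] vanishes there to order 3.  Three such parameters come from
   [a], [b] and their images under Miyamoto involutions, and 9 > 8. *)

From HB Require Import structures.
Require Import Defs.
From mathcomp Require Import all_boot all_order all_algebra.
From mathcomp Require Import boolp classical_sets.
From mathcomp Require Import ring.

Set Implicit Arguments.
Unset Strict Implicit.
Unset Printing Implicit Defensive.

Import GRing.Theory.
Local Open Scope classical_set_scope.
Local Open Scope ring_scope.

(** * Linear forms *)

Section LinearForms.
Context {K : fieldType} {V : lmodType K}.

Definition linear_form (f : V -> K) : Prop := linear_for *%R f.

(* A maximal subspace avoiding [x] is the kernel of the linear form. *)
Lemma exists_linear_form (x : V) : x != 0 ->
  exists2 f : V -> K, linear_form f & f x = 1.
Proof.
move=> x0.
pose closed (U : set V) := forall (k : K) u v, U u -> U v -> U (k *: u + v).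
pose P : set (set V) := [set U | closed U /\ ~ U x].
have [|U [[Ulin Ux] Umax]] := @Zorn_bigcup V P.
  move=> C CP Ctot; split=> [k u v [U CU Uu] [W CW Wv]|[U CU Ux]]; last first.
    by case: (CP _ CU).
  have [UW|WU] := Ctot _ _ CU CW.
  - by exists W => //; apply: (CP _ CW).1 => //; apply: UW.
  - by exists U => //; apply: (CP _ CU).1 => //; apply: WU.
(* [closed] does not ask for [0]. If [U] missed it, [U] would be empty and [[set 0]] would be a
   larger member of [P]. *)
have U0 : U 0.
  apply: contrapT => nU0; apply: (Umax [set 0]); last first.
    split=> [k u v -> ->|/eqP]; last by rewrite (negPf x0).
    by rewrite /= scaler0 addr0.
  split=> [u Uu|/(_ 0 erefl)//].
  by exfalso; apply: nU0; have := Ulin (-1) _ _ Uu Uu; rewrite scaleN1r addNr.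
have UZ k u : U u -> U (k *: u).
  by move=> Uu; rewrite -[_ *: _]addr0; apply: Ulin.
(* For [y] outside [U], the subspace [U + K y] is strictly larger, so by maximality it contains [x];
   solving for [y] gives [k]. *)
have coset y : exists k, U (y - k *: x).
  have [Uy|nUy] := pselect (U y); first by exists 0; rewrite scale0r subr0.
  have [[[u k] /= [Uu xE]]|nx] :=
      pselect (exists w : V * K, U w.1 /\ x = w.1 + w.2 *: y).
    have [k0|k0] := eqVneq k 0.
      by case: Ux; rewrite xE k0 scale0r addr0.
    exists k^-1; rewrite xE scalerDr scalerA mulVf // scale1r opprD addrC.
    by rewrite -addrA addNr addr0 -scaleNr; apply: UZ.
  exfalso; apply: (Umax [set z | exists w : V * K, U w.1 /\ z = w.1 +
    w.2 *: y]).
    split=> [u Uu|sub]; first by exists (u, 0); rewrite scale0r addr0.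
    by apply: nUy; apply: sub; exists (0, 1); rewrite scale1r add0r.
  split=> // k _ _ [[u l] [Uu ->]] [[v m] [Uv ->]].
  exists (k *: u + v, k * l + m); split; first exact: Ulin.
  by rewrite /= scalerDl scalerDr scalerA addrACA.
pose f y := sval (cid (coset y)).
have fE y : U (y - f y *: x) by rewrite /f; case: cid.
have funiq y k : U (y - k *: x) -> f y = k.
  move=> Uk; apply/eqP; rewrite -subr_eq0.
  apply: contra_notT Ux => d0.
  have := UZ (f y - k)^-1 _ (Ulin (-1) _ _ (fE y) Uk).
  rewrite scaleN1r opprB addrA subrK -scalerBl scalerA mulVf //.
  by rewrite scale1r.
exists f => [k u v|]; apply: funiq; last by rewrite scale1r subrr.
have := Ulin k _ _ (fE u) (fE v).
by rewrite scalerBr scalerA addrACA -opprD -scalerDl.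
Qed.

Section Theory.
Context (f : V -> K) (lf : linear_form f).

Lemma linear_formD u v : f (u + v) = f u + f v.
Proof. by rewrite -[u]scale1r lf scale1r mul1r. Qed.

Lemma linear_form0 : f 0 = 0.
Proof. by apply: (addrI (f 0)); rewrite -linear_formD !addr0. Qed.

Lemma linear_formZ k u : f (k *: u) = k * f u.
Proof. by rewrite -[k *: u]addr0 lf linear_form0 addr0. Qed.

Lemma linear_formN u : f (- u) = - f u.
Proof. by rewrite -scaleN1r linear_formZ mulN1r. Qed.

End Theory.

Lemma linear_form_ext (u v : V) :
  (forall f, linear_form f -> f u = f v) -> u = v.
Proof.
move=> uv; apply/eqP; rewrite -subr_eq0; apply: contraT => d0.
have [f lf fd] := exists_linear_form d0.
have /eqP := fd; rewrite (linear_formD lf) (linear_formN lf) (uv _ lf) subrr.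
by rewrite eq_sym oner_eq0.
Qed.

End LinearForms.

Ltac module_norm lf :=
  rewrite ?(linear_formD lf, linear_formN lf, linear_formZ lf,
            linear_form0 lf).

(* Module identities become commutative-ring identities under every linear
   form. *)
Ltac module_ring :=
  let f := fresh "f" in let lf := fresh "lf" in
  apply: linear_form_ext => f lf; module_norm lf; ring.

Ltac module_field :=
  let f := fresh "f" in let lf := fresh "lf" in
  apply: linear_form_ext => f lf; module_norm lf; field.

Section AmulTheory.
Context {K : fieldType} {A : comNAAlgType K}.
Implicit Types x y : A.

Lemma amul0r x : x ** 0 = 0. Proof. exact: linear0. Qed.
Lemma amul0l x : 0 ** x = 0. Proof. by rewrite amulC amul0r. Qed.
Lemma amulNr x y : x ** (- y) = - (x ** y). Proof. exact: linearN. Qed.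
Lemma amulNl x y : (- x) ** y = - (x ** y).
Proof. by rewrite amulC amulNr amulC. Qed.

End AmulTheory.

Ltac amul_expand :=
  rewrite ?(amulDl, amulDr, amulZl, amulZr, amulNl, amulNr, amul0l, amul0r).

(** * Axes as solutions of identities *)

Section AxisIdentities.
Context {K : fieldType} {A : comNAAlgType K}.
Implicit Types (n c x y : A) (N k : K).

(** This is [(N - 2 L_n)^2]: the polynomial [(1 - 2X)^2] takes the values 1, 1, 0 at 1, 0, 1/2. *)
Definition even_part n N x : A :=
  N ^+ 2 *: x - (4 * N) *: (n ** x) + 4 *: (n ** (n ** x)).

(** This is [L_n (L_n - N) (2 L_n - N)], with roots [0], [N] and [N / 2]. *)
Definition cubic_defect n N x : A :=
  2 *: (n ** (n ** (n ** x))) - (3 * N) *: (n ** (n ** x))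
    + N ^+ 2 *: (n ** x).

(** The Seress condition: [L_n] commutes with multiplication by even parts. *)
Definition seress_defect n N x y : A :=
  n ** (even_part n N x ** y) - even_part n N x ** (n ** y).

(** For [N = 1] and [S] the even part, this is half the failure of [2 S - 1] to be
    multiplicative. *)
Definition grading_defect n N x y : A :=
  N ^+ 2 *: even_part n N (x ** y)
    - 2 *: (even_part n N x ** even_part n N y)
    + N ^+ 2 *: (even_part n N x ** y + x ** even_part n N y)
    - N ^+ 4 *: (x ** y).

(* For [N = 1] these identities say that the idempotent [n] is a J(1/2)-axis:
   [even_part] is then the projection onto [A_1 + A_0] along [A_{1/2}].  They
   are homogeneous of degrees 6, 6 and 8 in [(n, N)]. *)
Record axis_identities n N : Prop := AxisIdentities {
  cubic0 : forall x, cubic_defect n N x = 0;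
  seress0 : forall x y, seress_defect n N x y = 0;
  grading0 : forall x y, grading_defect n N x y = 0
}.

Lemma even_partZ k n N x :
  even_part (k *: n) (k * N) x = k ^+ 2 *: even_part n N x.
Proof. by rewrite /even_part; amul_expand; module_ring. Qed.

(** The defects scale with the powers 3, 3 and 4 of [k]. When [n] and [N] are quadratic in a
    parameter, their degrees in it are thus at most 6, 6 and 8. *)
Lemma axis_identitiesZ k n N :
  axis_identities n N -> axis_identities (k *: n) (k * N).
Proof.
case=> j1 j2 j3; split=> [x|x y|x y].
- rewrite -[RHS](scaler0 _ (k ^+ 3)) -(j1 x) /cubic_defect; amul_expand.
  by module_ring.
- rewrite -[RHS](scaler0 _ (k ^+ 3)) -(j2 x y) /seress_defect !even_partZ.
  by amul_expand; module_ring.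
- rewrite -[RHS](scaler0 _ (k ^+ 4)) -(j3 x y) /grading_defect !even_partZ.
  by amul_expand; module_ring.
Qed.

Lemma axis_identitiesV n N : N != 0 ->
  axis_identities n N <-> axis_identities (N^-1 *: n) 1.
Proof.
move=> N0; split=> [/(axis_identitiesZ N^-1)|/(axis_identitiesZ N)].
  by rewrite mulVf.
by rewrite scalerA mulfV // scale1r mulr1.
Qed.

Hypothesis two0 : (2 : K) != 0.

Lemma even_part_half c x : c ** x = 2^-1 *: x -> even_part c 1 x = 0.
Proof.
move=> cx; rewrite /even_part; amul_expand; rewrite cx; amul_expand; rewrite cx.
by module_field.
Qed.

Lemma even_part_id c x : c ** (c ** x) = c ** x -> even_part c 1 x = x.
Proof. by move=> cx; rewrite /even_part cx; module_ring. Qed.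

Lemma even_part10 c x y : c ** x = x -> c ** y = 0 ->
  even_part c 1 (x + y) = x + y.
Proof.
by move=> cx cy; apply: even_part_id; amul_expand; rewrite cx cy; amul_expand;
   rewrite cx.
Qed.

Lemma peirce_ex c x : (forall x, cubic_defect c 1 x = 0) ->
  exists x1 x0 xh : A,
    [/\ c ** x1 = x1, c ** x0 = 0, c ** xh = 2^-1 *: xh & x = x1 + x0 + xh].
Proof.
move=> j1; have := j1 x; rewrite /cubic_defect => E.
have {}E : 2 *: (c ** (c ** (c ** x))) = 3 *: (c ** (c ** x)) - c ** x.
  by apply/eqP; rewrite -subr_eq0 -[X in _ == X]E; apply/eqP; module_ring.
have {}E : c ** (c ** (c ** x)) = 2^-1 *: (3 *: (c ** (c ** x)) - c ** x).
  by rewrite -E scalerA mulVf // scale1r.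
(* The projections are [X (2X - 1)], [(1 - X)(1 - 2X)] and [4X (1 - X)] at [L_c], the interpolation
   polynomials at 1, 0 and 1/2. *)
exists (2 *: (c ** (c ** x)) - c ** x).
exists (x - 3 *: (c ** x) + 2 *: (c ** (c ** x))).
exists (4 *: (c ** x - c ** (c ** x))).
split; last by module_ring.
- amul_expand; rewrite E.
  by module_field.
- amul_expand; rewrite E.
  by module_field.
- amul_expand; rewrite E.
  by module_field.
Qed.

(** The cubic identity amounts to the Peirce decomposition, the Seress identity yields the fusion
    rules with an even factor, and the grading identity the rule for two factors in [A_{1/2}]. *)
Lemma axis_identitiesP c : nz_idempotent c ->
  jhalf_axis c <-> axis_identities c 1.
Proof.
move=> cnz; split=> [[_ pd fu]|[j1 j2 j3]].
  have dec x : exists x1 x0 xh : A,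
      [/\ c ** x1 = x1, c ** x0 = 0, c ** xh = 2^-1 *: xh & x = x1 + x0 + xh].
    have [[[x1 x0] xh] [[/= e1 e0 eh xE] _]] := pd x.
    exists x1, x0, xh; split=> //; first by rewrite [LHS]e1 scale1r.
    by rewrite [LHS]e0 scale0r.
  have m11 x y : c ** x = x -> c ** y = y -> c ** (x ** y) = x ** y.
    move=> cx cy; rewrite -[RHS]scale1r; apply: (fusion11 fu).
    by exists x; [|exists y]; rewrite /eigen /= ?scale1r.
  have m00 x y : c ** x = 0 -> c ** y = 0 -> c ** (x ** y) = 0.
    move=> cx cy; rewrite -[RHS](scale0r (x ** y)); apply: (fusion00 fu).
    by exists x; [|exists y]; rewrite /eigen /= ?scale0r.
  have m10 x y : c ** x = x -> c ** y = 0 -> x ** y = 0.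
    move=> cx cy; apply: (fusion10 fu).
    by exists x; [|exists y]; rewrite /eigen /= ?scale0r ?scale1r.
  have m1h x y : c ** x = x -> c ** y = 2^-1 *: y ->
      c ** (x ** y) = 2^-1 *: (x ** y).
    move=> cx cy; apply: (fusion1h fu).
    by exists x; [|exists y]; rewrite /eigen /= ?scale1r.
  have m0h x y : c ** x = 0 -> c ** y = 2^-1 *: y ->
      c ** (x ** y) = 2^-1 *: (x ** y).
    move=> cx cy; apply: (fusion0h fu).
    by exists x; [|exists y]; rewrite /eigen /= ?scale0r.
  have mhh x y : c ** x = 2^-1 *: x -> c ** y = 2^-1 *: y ->
      c ** (c ** (x ** y)) = c ** (x ** y).
    move=> cx cy; have [|u eu [v ev <-]] := fusionhh fu (_ : prodset _ _ (x **
      y)).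
      by exists x => //; exists y.
    have cu : c ** u = u by rewrite [LHS]eu scale1r.
    have cv : c ** v = 0 by rewrite [LHS]ev scale0r.
    by rewrite amulDr cu cv addr0 cu.
  have evE x1 x0 xh : c ** x1 = x1 -> c ** x0 = 0 -> c ** xh = 2^-1 *: xh ->
      even_part c 1 (x1 + x0 + xh) = x1 + x0.
    move=> c1 c0 ch.
    rewrite -[RHS](even_part10 c1 c0) -[RHS]addr0 -[in RHS](even_part_half ch).
    by rewrite /even_part; amul_expand; module_ring.
  split=> [x|x y|x y].
  - have [x1 [x0 [xh [c1 c0 ch ->]]]] := dec x.
    rewrite /cubic_defect; do 3![amul_expand; rewrite ?c1 ?c0 ?ch].
    by amul_expand; module_field.
  - have [x1 [x0 [xh [c1 c0 ch ->]]]] := dec x.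
    have [y1 [y0 [yh [d1 d0 dh ->]]]] := dec y.
    rewrite /seress_defect evE //; amul_expand.
    rewrite d1 d0 dh ?amulDr ?amulDl ?amulZr ?amul0r.
    rewrite (m10 _ _ c1 d0) (amulC x0 y1) (m10 _ _ d1 c0) (m11 _ _ c1 d1).
    rewrite (m00 _ _ c0 d0) (m1h _ _ c1 dh) (m0h _ _ c0 dh); amul_expand.
    by module_ring.
  - have [x1 [x0 [xh [c1 c0 ch ->]]]] := dec x.
    have [y1 [y0 [yh [d1 d0 dh ->]]]] := dec y.
    rewrite /grading_defect !evE // expr1n !scale1r.
    have -> : (x1 + x0 + xh) ** (y1 + y0 + yh)
        = (x1 ** y1 + x0 ** y0 + (x1 + x0) ** yh + (y1 + y0) ** xh)
          + xh ** yh.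
      amul_expand; rewrite (m10 _ _ c1 d0) (amulC x0 y1) (m10 _ _ d1 c0).
      by rewrite (amulC y1) (amulC y0); module_ring.
    have evD u v : even_part c 1 (u + v) = even_part c 1 u + even_part c 1 v.
      by rewrite /even_part; amul_expand; module_ring.
    rewrite (evD _ (xh ** yh)) (even_part_id (mhh _ _ ch dh)).
    rewrite (evD _ ((y1 + y0) ** xh)) (evD _ ((x1 + x0) ** yh)).
    rewrite (even_part10 (m11 _ _ c1 d1) (m00 _ _ c0 d0)).
    rewrite !even_part_half; last 2 first.
    - by amul_expand; rewrite m1h // m0h //; module_ring.
    - by amul_expand; rewrite m1h // m0h //; module_ring.
    amul_expand; rewrite (m10 _ _ c1 d0) (amulC x0 y1) (m10 _ _ d1 c0).
    by rewrite (amulC y1 xh) (amulC y0 xh); module_ring.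
have s1 x : c ** x = x -> even_part c 1 x = x.
  by move=> cx; apply: even_part_id; rewrite !cx.
have s0 x : c ** x = 0 -> even_part c 1 x = x.
  by move=> cx; apply: even_part_id; rewrite !cx amul0r.
have ser x y : even_part c 1 x = x -> c ** (x ** y) = x ** (c ** y).
  by move=> sx; apply/eqP; rewrite -subr_eq0; have := j2 x y;
     rewrite /seress_defect sx => ->.
split=> //.
- move=> x; have [x1 [x0 [xh [c1 c0 ch xE]]]] := peirce_ex x j1.
  exists (x1, x0, xh); split=> [|[[y1 y0] yh] [/= d1 d0 dh yE]].
    by split; rewrite /eigen /= ?scale1r ?scale0r.
  move: d1 d0 dh; rewrite /eigen /= scale1r scale0r => d1 d0 dh.
  (* The interpolation polynomials recover the components, which gives uniqueness. *)
  have p1 u v w : c ** u = u -> c ** v = 0 -> c ** w = 2^-1 *: w ->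
      2 *: (c ** (c ** (u + v + w))) - c ** (u + v + w) = u.
    move=> cu cv cw; do 2![amul_expand; rewrite ?cu ?cv ?cw].
    by amul_expand; module_field.
  have ph u v w : c ** u = u -> c ** v = 0 -> c ** w = 2^-1 *: w ->
      4 *: (c ** (u + v + w) - c ** (c ** (u + v + w))) = w.
    move=> cu cv cw; do 2![amul_expand; rewrite ?cu ?cv ?cw].
    by amul_expand; module_field.
  have E1 : x1 = y1 by rewrite -(p1 x1 x0 xh) // -(p1 y1 y0 yh) // -xE -yE.
  have Eh : xh = yh by rewrite -(ph x1 x0 xh) // -(ph y1 y0 yh) // -xE -yE.
  congr (_, _, _) => //; move: xE; rewrite yE E1 Eh => /addIr/addrI.
  by move=> ->.
- split=> _ [x ex [y ey <-]]; move: ex ey; rewrite /eigen /= ?scale1r ?scale0r.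
  + by move=> cx cy; rewrite ser ?s1 // cy.
  + by move=> cx cy; rewrite ser ?s0 // cy amul0r.
  (* Moving [c] past [y] shows that it fixes the product; moving it past [x] shows that it kills
     it. *)
  + move=> cx cy; have := ser y x (s0 _ cy).
    by rewrite cx (amulC y) ser ?s1 // cy amul0r => ->.
  + by move=> cx cy; rewrite ser ?s1 // cy amulZr.
  + by move=> cx cy; rewrite ser ?s0 // cy amulZr.
  (* Both even parts vanish, so the identity says that [x ** y] equals its own even part. *)
  + move=> cx cy; have := j3 x y.
    rewrite /grading_defect (even_part_half cx) (even_part_half cy).
    amul_expand; rewrite !expr1n !scale1r /even_part => E.
    have cc : c ** (c ** (x ** y)) = c ** (x ** y).
      apply/eqP; rewrite -subr_eq0.
      have : 4 *: (c ** (c ** (x ** y)) - c ** (x ** y)) = 0.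
        by rewrite -[RHS]E; module_ring.
      move/eqP; rewrite scaler_eq0 (_ : 4 = 2 * 2 :> K) ?mulf_eq0; last by ring.
      by rewrite (negPf two0).
    exists (c ** (x ** y)); first by rewrite /eigen /= scale1r.
    exists (x ** y - c ** (x ** y)); last by rewrite addrC subrK.
    by rewrite /eigen /= scale0r; amul_expand; rewrite cc subrr.
Qed.

End AxisIdentities.

(** * Vector-valued polynomial functions *)

Section PolynomialFunctions.
Context {K : fieldType}.

(** The list [s] is an element of [K[t] (x) V] of degree at most [d] in [t]; its formal derivative
    is carried along as [g']. *)
Definition polyfun {V : lmodType K} (d : nat) (g g' : K -> V) : Prop :=
  exists2 s : seq ({poly K} * V), all (fun p : {poly K} * V => size p.1 <=
    d.+1)%N s &
    forall t, g t = \sum_(p <- s) p.1.[t] *: p.2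
           /\ g' t = \sum_(p <- s) p.1^`().[t] *: p.2.

Section Module.
Context {V : lmodType K}.
Implicit Types (g : K -> V) (d : nat) (p : {poly K}).

Lemma polyfun_eq d g g' f f' :
  polyfun d g g' -> g =1 f -> g' =1 f' -> polyfun d f f'.
Proof.
by move=> [s sz gE] gf gf'; exists s => // t; rewrite -gf -gf'; apply: gE.
Qed.

Lemma polyfun_cst (v : V) : polyfun 0 (fun=> v) (fun=> 0).
Proof.
exists [:: (1, v)] => [|t]; first by rewrite /= size_poly1.
by rewrite !big_seq1 derivC !hornerE scale1r scale0r.
Qed.

Lemma polyfun_widen d e g g' : (d <= e)%N -> polyfun d g g' -> polyfun e g g'.
Proof.
move=> de [s sz gE]; exists s => //; apply: sub_all sz => p /= sp.
exact: leq_trans sp _.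
Qed.

Lemma polyfunD d g g' f f' : polyfun d g g' -> polyfun d f f' ->
  polyfun d (fun t => g t + f t) (fun t => g' t + f' t).
Proof.
move=> [s sz gE] [r rz fE]; exists (s ++ r); first by rewrite all_cat sz.
by move=> t; rewrite !big_cat /=; case: (gE t) (fE t) => -> -> [-> ->].
Qed.

Lemma polyfunZ d e g g' p : (size p <= e.+1)%N -> polyfun d g g' ->
  polyfun (d + e) (fun t => p.[t] *: g t)
                  (fun t => p^`().[t] *: g t + p.[t] *: g' t).
Proof.
move=> pz [s sz gE]; exists [seq (p * r.1, r.2) | r : {poly K} * V <- s].
  rewrite all_map; apply: sub_all sz => r /= rz.
  apply: leq_trans (size_polyMleq _ _) _.
  rewrite -subn1 leq_subLR; apply: leq_trans (leq_add pz rz) _.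
  by rewrite addSn addnS add1n addnC.
move=> t; rewrite !big_map; case: (gE t) => -> ->; split.
  rewrite scaler_sumr; apply: eq_bigr => r _ /=.
  by rewrite hornerM scalerA.
rewrite !scaler_sumr -big_split; apply: eq_bigr => r _ /=.
by rewrite derivM hornerD !hornerM scalerDl !scalerA.
Qed.

Lemma polyfunZc d g g' k : polyfun d g g' ->
  polyfun d (fun t => k *: g t) (fun t => k *: g' t).
Proof.
move=> gP; have := polyfunZ (e := 0) (p := k%:P) (size_polyC_leq1 _) gP.
rewrite addn0 => /polyfun_eq; apply=> t; first by rewrite hornerC.
by rewrite derivC !hornerE scale0r add0r.
Qed.

Lemma polyfun_linear (L : V -> V) d g g' : linear L -> polyfun d g g' ->
  polyfun d (fun t => L (g t)) (fun t => L (g' t)).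
Proof.
move=> lL [s sz gE]; exists [seq (p.1, L p.2) | p : {poly K} * V <- s].
  by rewrite all_map.
pose f : {linear V -> V} := HB.pack L (GRing.isLinear.Build _ _ _ _ L lL).
move=> t; rewrite !big_map; case: (gE t) => -> ->.
by split; rewrite -[L]/(f : _ -> _) linear_sum; apply: eq_bigr => p _;
   rewrite linearZ.
Qed.

Lemma polyfun_deriv d g g' : polyfun d g g' ->
  exists g'', polyfun d g' g''.
Proof.
move=> [s sz gE].
exists (fun t => \sum_(p <- s) p.1^`()^`().[t] *: p.2).
exists [seq (p.1^`(), p.2) | p : {poly K} * V <- s].
  rewrite all_map; apply: sub_all sz => p /= pz.
  by rewrite (leq_trans _ pz) // (leq_trans (size_poly _ _)) // leq_pred.
by move=> t; rewrite !big_map; case: (gE t) => _ ->.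
Qed.

Lemma polyfun_form d g g' (f : V -> K) : linear_form f -> polyfun d g g' ->
  exists2 p : {poly K}, (size p <= d.+1)%N &
    forall t, f (g t) = p.[t] /\ f (g' t) = p^`().[t].
Proof.
move=> lf [s sz gE].
have fsum (F : {poly K} * V -> K) :
    f (\sum_(p <- s) F p *: p.2) = \sum_(p <- s) F p * f p.2.
  elim: (s) => [|p r IHr]; first by rewrite !big_nil linear_form0.
  by rewrite !big_cons linear_formD // linear_formZ // IHr.
exists (\sum_(p <- s) f p.2 *: p.1).
  rewrite big_seq; apply: (big_ind (fun p : {poly K} => size p <= d.+1)%N).
  - by rewrite size_poly0.
  - by move=> p r pz rz; apply: leq_trans (size_polyD _ _) _;
      rewrite geq_max pz.
  - by move=> p /(allP sz); apply: leq_trans (size_scale_leq _ _).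
move=> t; case: (gE t) => -> ->; rewrite !fsum linear_sum !horner_sum.
by split; apply: eq_bigr => p _ /=; rewrite ?derivZ hornerZ mulrC.
Qed.

End Module.

Lemma polyfun_amul {A : comNAAlgType K} d e (g g' f f' : K -> A) :
  polyfun d g g' -> polyfun e f f' ->
  polyfun (d + e) (fun t => g t ** f t) (fun t => g' t ** f t + g t ** f' t).
Proof.
move=> [s sz gE] [r rz fE].
have sumM (F G : {poly K} * A -> K) :
    (\sum_(p <- s) F p *: p.2) ** (\sum_(p <- r) G p *: p.2) =
    \sum_(p <- s) \sum_(l <- r) (F p * G l) *: (p.2 ** l.2).
  rewrite amulC linear_sum; apply: eq_bigr => p _ /=.
  rewrite amulC linear_sum; apply: eq_bigr => l _ /=.
  by rewrite amulZl amulZr scalerA.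
exists [seq (p.1 * l.1, p.2 ** l.2) | p <- s, l <- r].
  apply/allP => _ /allpairsP[[p l] [/= ps lr ->]] /=.
  apply: leq_trans (size_polyMleq _ _) _.
  rewrite -subn1 leq_subLR.
  apply: leq_trans (leq_add (allP sz _ ps) (allP rz _ lr)) _.
  by rewrite addSn addnS add1n.
move=> t; case: (gE t) (fE t) => -> -> [-> ->].
rewrite !big_allpairs_dep !sumM -big_split; split; apply: eq_bigr => p _ /=.
  by apply: eq_bigr => l _; rewrite hornerM.
rewrite -big_split; apply: eq_bigr => l _ /=.
by rewrite derivM hornerD !hornerM scalerDl.
Qed.

End PolynomialFunctions.

(** * Zeros of polynomial functions over an algebraically closed field *)

Section Vanishing.
Context {K : closedFieldType} {V : lmodType K}.
Implicit Types (g : K -> V) (d : nat).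

(** The product [p * r] vanishes everywhere, and an algebraically closed field is infinite. *)
Lemma poly_eq0_nonroots (p r : {poly K}) : r != 0 ->
  (forall t, r.[t] != 0 -> p.[t] = 0) -> p = 0.
Proof.
move=> r0 rp; apply/eqP; apply: contraT => p0.
have /closed_nonrootP[t] : p * r != 0 by rewrite mulf_neq0.
rewrite /root hornerM mulf_eq0 negb_or => /andP[pt /rp pt0].
by rewrite pt0 eqxx in pt.
Qed.

(** This allows an identity known only where [N] is nonzero to be extended to all parameters and
    differentiated. *)
Lemma polyfun_eq0 d g g' (r : {poly K}) : r != 0 -> polyfun d g g' ->
  (forall t, r.[t] != 0 -> g t = 0) -> forall t, g t = 0 /\ g' t = 0.
Proof.
move=> r0 gP g0 t.
have fg f : linear_form f -> f (g t) = 0 /\ f (g' t) = 0.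
  move=> lf; have [p _ pE] := polyfun_form lf gP.
  suff p0 : p = 0 by case: (pE t) => -> ->; rewrite p0 derivC horner0.
  apply: poly_eq0_nonroots r0 _ => u /g0 gu.
  by case: (pE u) => <- _; rewrite gu linear_form0.
by split; apply: linear_form_ext => f lf; rewrite (linear_form0 lf);
   case: (fg f lf).
Qed.

(** After two linear factors are split off, the second derivative at [t] is twice the value of the
    cofactor; characteristic 3 does no harm. *)
Lemma triple_root (p : {poly K}) (t : K) : (2 : K) != 0 ->
  p.[t] = 0 -> p^`().[t] = 0 -> p^`()^`().[t] = 0 -> ('X - t%:P) ^+ 3 %| p.
Proof.
move=> two0 /eqP/factor_theorem[r ->].
rewrite !derivE !hornerE subrr mulr0 add0r => /eqP/factor_theorem[s ->].
rewrite !(derivM, derivD, derivXsubC, derivC, derivX, derivN).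
rewrite !(hornerD, hornerM, hornerN, hornerX, hornerC) /= => st.
have /eqP/factor_theorem[l ->] : s.[t] = 0.
  by apply: (mulfI two0); rewrite mulr0 -[RHS]st; ring.
by rewrite -!mulrA -!expr2 -exprS dvdp_mull.
Qed.

(** Under any linear form, pairwise coprime cubes divide a polynomial of degree less than that of
    their product. *)
Lemma polyfun_triple_roots d g g' g'' (t : K) (rs : seq K) :
  (2 : K) != 0 -> (d < 3 * size rs)%N -> uniq rs ->
  polyfun d g g' -> polyfun d g' g'' ->
  {in rs, forall u, [/\ g u = 0, g' u = 0 & g'' u = 0]} -> g t = 0.
Proof.
move=> two0 dn urs gP g'P g0; apply: linear_form_ext => f lf.
have [p pz pE] := polyfun_form lf gP; have [r _ rE] := polyfun_form lf g'P.
(* The two hypotheses come with separate lists of polynomials; they agree as functions, hence as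
   polynomials. *)
have pr : r = p^`().
  apply/eqP; rewrite -subr_eq0; apply/eqP.
  apply: (@poly_eq0_nonroots _ 1); rewrite ?oner_eq0 // => u _.
  by rewrite !hornerE; case: (rE u) => <- _; case: (pE u) => _ <-;
    rewrite subrr.
have dvd (s : seq K) : uniq s -> {subset s <= rs} ->
    \prod_(u <- s) ('X - u%:P) ^+ 3 %| p.
  elim: s => [|u s IHs] /= => [_ _|/andP[us uns] sub].
    by rewrite big_nil dvd1p.
  rewrite big_cons Gauss_dvdp.
    rewrite IHs // => [|v vs]; last by rewrite sub // in_cons vs orbT.
    have [|gu g'u g''u] := g0 u; first by rewrite sub // mem_head.
    rewrite andbT; apply: triple_root two0 _ _ _.
    - by case: (pE u) => <- _; rewrite gu linear_form0.
    - by case: (pE u) => _ <-; rewrite g'u linear_form0.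
    - by rewrite -pr; case: (rE u) => _ <-; rewrite g''u linear_form0.
  rewrite coprimep_expl // coprimep_sym coprimep_XsubC rootE horner_prod.
  rewrite prodf_seq_neq0; apply/allP => v vs /=.
  rewrite !hornerE expf_neq0 // subr_eq0.
  by apply: contraNneq us => ->.
have {}dvd := dvd rs urs (fun u ur => ur).
suff p0 : p = 0 by case: (pE t) => -> _; rewrite p0 horner0 linear_form0.
apply: contraTeq dvd => p0; apply/negP => /(dvdp_leq p0); apply/negP.
rewrite -ltnNge prodrXl (leq_ltn_trans pz) //.
set m := _ ^+ 3; have m0 : m != 0.
  rewrite expf_neq0 // prodf_seq_neq0; apply/allP => u _ /=.
  by rewrite polyXsubC_eq0.
rewrite -[X in (_ < X)%N]prednK ?size_poly_gt0 // ltnS.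
by rewrite size_exp size_prod_XsubC mulnC.
Qed.

End Vanishing.
(** * Curves of idempotents and derivations *)

Lemma scalerC {R : comPzRingType} {V : lmodType R} (k l : R) (v : V) :
  k *: (l *: v) = l *: (k *: v).
Proof. by rewrite !scalerA mulrC. Qed.

Section Flow.
Context {K : closedFieldType} {A : comNAAlgType K}.
Variables (D : A -> A) (q : K).
Hypothesis lD : linear D.
Hypothesis DM : forall x y, D (x ** y) = D x ** y + x ** D y.
Local Notation N t := (1 + q * t ^+ 2).
Implicit Types (e d : K -> A) (w : nat).

Lemma flow_fieldD x y : D (x + y) = D x + D y.
Proof. by rewrite -[x]scale1r lD !scale1r. Qed.

Lemma flow_field0 : D 0 = 0.
Proof. by apply: (addrI (D 0)); rewrite -flow_fieldD !addr0. Qed.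

Lemma flow_fieldZ k x : D (k *: x) = k *: D x.
Proof. by rewrite -[k *: x]addr0 lD flow_field0 addr0. Qed.

(* [e] is a form of weight [w] in [t] on which [D - d], with [d] the part of
   the action of [D] through the other arguments of [e], is the vector field
   [- N d/dt / 4]. *)
Definition flow w e d : Prop := exists2 e', polyfun w e e' &
  forall t, N t *: e' t = (w%:R * q * t) *: e t - 4 *: (D (e t) - d t).

Lemma flow_eq w e d e1 d1 : flow w e d -> e =1 e1 -> d =1 d1 -> flow w e1 d1.
Proof.
move=> [e' eP ee] E1 E2; exists e' => [|t]; first exact: polyfun_eq eP E1 _.
by rewrite ee E1 E2.
Qed.

Lemma flow_cst x : flow 0 (fun=> x) (fun=> D x).
Proof.
exists (fun=> 0); first exact: polyfun_cst.
by move=> t; rewrite subrr !scaler0 !mul0r scale0r subr0.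
Qed.

Lemma flowD w e d e1 d1 : flow w e d -> flow w e1 d1 ->
  flow w (fun t => e t + e1 t) (fun t => d t + d1 t).
Proof.
move=> [e' eP ee] [f' fP fe].
exists (fun t => e' t + f' t); first exact: polyfunD.
by move=> t; rewrite scalerDr ee fe flow_fieldD; module_ring.
Qed.

Lemma flowZ w e d k : flow w e d ->
  flow w (fun t => k *: e t) (fun t => k *: d t).
Proof.
move=> [e' eP ee]; exists (fun t => k *: e' t); first exact: polyfunZc.
by move=> t; rewrite scalerC ee flow_fieldZ; module_ring.
Qed.

Lemma flowB w e d e1 d1 : flow w e d -> flow w e1 d1 ->
  flow w (fun t => e t - e1 t) (fun t => d t - d1 t).
Proof.
move=> eP /(flowZ (-1)) /(flowD eP) /flow_eq; apply=> t.
  by rewrite scaleN1r.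
by rewrite scaleN1r.
Qed.

Lemma polyfunN w e e' : polyfun w e e' ->
  polyfun w.+2 (fun t => N t *: e t) (fun t => (2 * q * t) *: e t + N t *: e'
    t).
Proof.
pose p : {poly K} := 1 + q *: 'X^2 => eP.
have pE t : p.[t] = N t by rewrite /p !hornerE.
have p'E t : p^`().[t] = 2 * q * t by rewrite /p !derivE !hornerE /=; ring.
have sp : (size p <= 3)%N.
  rewrite (leq_trans (size_polyD _ _)) // geq_max size_poly1 /=.
  by rewrite (leq_trans (size_scale_leq _ _)) // size_polyXn.
have := polyfunZ sp eP; rewrite addn2 => /polyfun_eq; apply=> t.
  by rewrite pE.
by rewrite pE p'E.
Qed.

(** [N] is itself a form of weight 2 with no [D] part, since [N' = 2 q t]. *)
Lemma flowN w e d : flow w e d ->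
  flow w.+2 (fun t => N t *: e t) (fun t => N t *: d t).
Proof.
move=> [e' eP ee].
exists (fun t => (2 * q * t) *: e t + N t *: e' t).
  exact: polyfunN.
move=> t; rewrite scalerDr [X in _ + X]scalerC ee flow_fieldZ.
by apply: linear_form_ext => f lf; module_norm lf; rewrite -addn2 natrD; ring.
Qed.

(** Both [D] and [d/dt] obey the Leibniz rule, and weights add. *)
Lemma flowM w v e d e1 d1 : flow w e d -> flow v e1 d1 ->
  flow (w + v) (fun t => e t ** e1 t) (fun t => d t ** e1 t + e t ** d1 t).
Proof.
move=> [e' eP ee] [f' fP fe].
exists (fun t => e' t ** e1 t + e t ** f' t); first exact: polyfun_amul.
move=> t; rewrite scalerDr -amulZl -amulZr ee fe DM; amul_expand.
by apply: linear_form_ext => f lf; module_norm lf; rewrite natrD; ring.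
Qed.

Section Vanishing.
Variables (Z : Type) (w : nat) (G dG : Z -> K -> A).
Hypothesis GP : forall z, flow w (G z) (dG z).
Hypothesis dGP : forall z, exists z1 z2, forall t, dG z t = G z1 t + G z2 t.

(* At a common zero of the family the flow equation and its derivative kill
   the first two derivatives; over characteristic 3 one cannot go further. *)
Lemma flow_eq0 (rs : seq K) : (2 : K) != 0 -> (w < 3 * size rs)%N -> uniq rs ->
  {in rs, forall u, N u != 0 /\ forall z, G z u = 0} -> forall z t, G z t = 0.
Proof.
move=> two0 ws urs G0 z t.
(* At a common zero the flow equation reduces to [N e' = 0], as [dG] is a sum of two members of the
   family. *)
have G'0 y e' u : u \in rs -> polyfun w (G y) e' ->
    (forall s, N s *: e' s = (w%:R * q * s) *: G y s - 4 *: (D (G y s) - dG y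
      s))
    -> e' u = 0.
  move=> /G0[Nu Gu] _ /(_ u); have [z1 [z2 ->]] := dGP y.
  rewrite !Gu flow_field0 addr0 subrr !scaler0 subrr => /eqP.
  by rewrite scaler_eq0 (negPf Nu) => /eqP.
have [e' eP ee] := GP z; have [z1 [z2 dE]] := dGP z.
have [e1 e1P e1e] := GP z1; have [e2 e2P e2e] := GP z2.
have [e'' e'P] := polyfun_deriv eP.
apply: (polyfun_triple_roots t two0 ws urs eP e'P) => u us.
have [Nu Gu] := G0 _ us; split; [exact: Gu|exact: G'0 us eP ee|].
(* [rP] is the flow equation with all terms on one side. Its derivative at [u] reduces to [N e''],
   because the first derivatives of all members of the family vanish there. *)
pose p : {poly K} := (- (w%:R * q)) *: 'X.
have sp : (size p <= 2)%N.
  by rewrite (leq_trans (size_scale_leq _ _)) // size_polyX.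
have pE s : p.[s] = - (w%:R * q * s) by rewrite /p !hornerE mulNr.
have p'E s : p^`().[s] = - (w%:R * q) by rewrite /p !derivE !hornerE.
have w1 : (w + 1 <= w.+2)%N by rewrite addn1.
have w2 : (w <= w.+2)%N by rewrite ltnW.
have rP := polyfunD (polyfunN e'P) (polyfunD
  (polyfun_widen w1 (polyfunZ sp eP))
  (polyfun_widen w2 (polyfunZc 4 (polyfunD (polyfun_linear lD eP)
     (polyfunZc (-1) (polyfunD e1P e2P)))))).
have [|_] := polyfun_eq0 (oner_neq0 _) rP _ u.
  by move=> s _; rewrite pE ee dE; module_ring.
rewrite (G'0 _ _ _ us eP ee) (G'0 _ _ _ us e1P e1e) (G'0 _ _ _ us e2P e2e) Gu.
rewrite flow_field0 !(addr0, scaler0, add0r) => /eqP.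
by rewrite scaler_eq0 (negPf Nu) => /eqP.
Qed.

End Vanishing.

(** * The axis identities along a quadratic curve *)

Section Curve.
Variables v0 v1 v2 : A.
Local Notation n t := (v0 + t *: v1 + t ^+ 2 *: v2).

Lemma polyfun_curve : polyfun 2 (fun t => n t) (fun t => v1 + (2 * t) *: v2).
Proof.
exists [:: (1, v0); ('X, v1); ('X^2, v2)] => [|t].
  by rewrite /= size_poly1 size_polyX size_polyXn.
rewrite !big_cons !big_nil /= !derivE !hornerE /=.
by split; module_ring.
Qed.

(** The value at 0 uses [N = 1], [N' = 0] and [n' = v1] there. *)
Lemma polyfun_even_part w e e' : polyfun w e e' -> exists2 f',
  polyfun w.+4 (fun t => even_part (n t) (N t) (e t)) f' &
  f' 0 = even_part v0 1 (e' 0)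
         + 4 *: (v1 ** (v0 ** e 0) + v0 ** (v1 ** e 0) - v1 ** e 0).
Proof.
move=> eP; have nP := polyfun_amul polyfun_curve.
have := polyfunD (polyfunD (polyfunN (polyfunN eP))
   (polyfunZc (-4) (polyfunN (nP _ _ _ eP))))
   (polyfunZc 4 (nP _ _ _ (nP _ _ _ eP))).
set f' := (X in polyfun _ _ X) => fP; exists f'.
  by apply: polyfun_eq fP _ _ => // t; rewrite /even_part; module_ring.
rewrite /f' /even_part !(mulr0, scale0r, addr0, expr0n, scale1r, add0r) /=.
by amul_expand; module_ring.
Qed.

Hypothesis flow_n : forall t,
  4 *: D (n t) = (2 * q * t) *: n t - N t *: (v1 + (2 * t) *: v2).

Lemma flow_curve : flow 2 (fun t => n t) (fun=> 0).
Proof.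
exists (fun t => v1 + (2 * t) *: v2); first exact: polyfun_curve.
by move=> t; rewrite subr0 flow_n; module_ring.
Qed.

Lemma flow_curveM w e d : flow w e d ->
  flow w.+2 (fun t => n t ** e t) (fun t => n t ** d t).
Proof.
by move/(flowM flow_curve)/flow_eq; apply=> t //; rewrite amul0l add0r.
Qed.

Lemma flow_even_part w e d : flow w e d ->
  flow w.+4 (fun t => even_part (n t) (N t) (e t))
            (fun t => even_part (n t) (N t) (d t)).
Proof.
move=> eP; have := flowD (flowB (flowN (flowN eP))
  (flowZ 4 (flowN (flow_curveM eP)))) (flowZ 4 (flow_curveM (flow_curveM eP))).
by move/flow_eq; apply=> t; rewrite /even_part; module_ring.
Qed.

(** The defects are built from [n], [N] and constants by the rules above. Since [n] and [N] have no
    [D] part, [D] only hits the arguments. *)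
Lemma flow_cubic x :
  flow 6 (fun t => cubic_defect (n t) (N t) x)
         (fun t => cubic_defect (n t) (N t) (D x)).
Proof.
have nP := flow_curveM (flow_cst x); have nnP := flow_curveM nP.
have := flowD (flowB (flowZ 2 (flow_curveM nnP)) (flowZ 3 (flowN nnP)))
  (flowN (flowN nP)).
by move/flow_eq; apply=> t; rewrite /cubic_defect; module_ring.
Qed.

Lemma flow_seress x y :
  flow 6 (fun t => seress_defect (n t) (N t) x y)
         (fun t => seress_defect (n t) (N t) (D x) y
                   + seress_defect (n t) (N t) x (D y)).
Proof.
have xP := flow_cst x; have yP := flow_cst y.
have sP := flow_even_part xP.
have := flowB (flow_curveM (flowM sP yP)) (flowM sP (flow_curveM yP)).
move/flow_eq; apply=> t; first exact: erefl.
by rewrite /seress_defect amulDr; module_ring.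
Qed.

Lemma flow_grading x y :
  flow 8 (fun t => grading_defect (n t) (N t) x y)
         (fun t => grading_defect (n t) (N t) (D x) y
                   + grading_defect (n t) (N t) x (D y)).
Proof.
have xP := flow_cst x; have yP := flow_cst y.
have xyP := flowM xP yP.
have sxP := flow_even_part xP; have syP := flow_even_part yP.
have NN w e d := fun eP : flow w e d => flowN (flowN eP).
have := flowB (flowD (flowB (NN _ _ _ (flow_even_part xyP))
  (flowZ 2 (flowM sxP syP))) (NN _ _ _ (flowD (flowM sxP yP) (flowM xP syP))))
  (NN _ _ _ (NN _ _ _ xyP)).
move/flow_eq; apply=> t; rewrite /grading_defect; first by module_ring.
have sD u v : even_part (n t) (N t) (u + v)
    = even_part (n t) (N t) u + even_part (n t) (N t) v.
  by rewrite /even_part; amul_expand; module_ring.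
by rewrite sD; module_ring.
Qed.

(** Zeros of order 3 at three parameters exceed the weights 6, 6 and 8. *)
Lemma axis_identities_curve (rs : seq K) :
  (2 : K) != 0 -> uniq rs -> size rs = 3 ->
  {in rs, forall u, N u != 0 /\ axis_identities (n u) (N u)} ->
  forall t, axis_identities (n t) (N t).
Proof.
move=> two0 urs rs3 axrs t.
have sz w : (w < 9)%N -> (w < 3 * size rs)%N by rewrite rs3.
split=> [x|x y|x y].
- apply: (flow_eq0 flow_cubic _ two0 (sz 6 isT) urs) => [y|u /axrs[]].
    (* A cubic defect has a single argument; the second summand is the defect at 0. *)
    by exists (D y), 0 => s;
      rewrite /cubic_defect !amul0r !scaler0 subr0 !addr0.
  by move=> Nu [j1 _ _].
- apply: (flow_eq0 (G := fun z s => seress_defect (n s) (N s) z.1 z.2)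
    (fun z => flow_seress z.1 z.2) _ two0 (sz 6 isT) urs _ (x, y)).
    by move=> [u v]; exists (D u, v), (u, D v).
  by move=> u /axrs[Nu [_ j2 _]]; split=> // z; apply: j2.
- apply: (flow_eq0 (G := fun z s => grading_defect (n s) (N s) z.1 z.2)
    (fun z => flow_grading z.1 z.2) _ two0 (sz 8 isT) urs _ (x, y)).
    by move=> [u v]; exists (D u, v), (u, D v).
  by move=> u /axrs[Nu [_ _ j3]]; split=> // z; apply: j3.
Qed.

End Curve.

End Flow.
(** * Two-generated subalgebras *)

Section TwoGenerated.
Context {K : fieldType} {A : comNAAlgType K}.

(* The multiplication table of the subalgebra generated by [a] and [b] in
   terms of the Peirce components [phi *: a], [h] and [b0] of [b] with respect
   to [a]. *)
Record peirce_table (phi : K) (a h b0 : A) : Prop := PeirceTable {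
  tab_aa : a ** a = a;
  tab_ah : a ** h = 2^-1 *: h;
  tab_a0 : a ** b0 = 0;
  tab_hh : h ** h = (phi * (1 - phi)) *: a + phi *: b0;
  tab_0h : b0 ** h = ((1 - phi) / 2) *: h;
  tab_00 : b0 ** b0 = (1 - phi) *: b0
}.

Hypothesis two0 : (2 : K) != 0.

(** Applying [a] once and twice separates the three eigenvalues. *)
Lemma peirce_eq0 (a x1 x0 xh : A) :
  a ** x1 = x1 -> a ** x0 = 0 -> a ** xh = 2^-1 *: xh -> x1 + x0 + xh = 0 ->
  [/\ x1 = 0, x0 = 0 & xh = 0].
Proof.
move=> a1 a0 ah E.
have E1 : x1 + 2^-1 *: xh = 0.
  by rewrite -[RHS](amul0r a) -E; amul_expand; rewrite a1 a0 ah addr0.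
have E2 : x1 + 2^-1 *: (2^-1 *: xh) = 0.
  by rewrite -[RHS](amul0r a) -E1; amul_expand; rewrite a1 ah.
have xh0 : xh = 0.
  rewrite -[LHS]scale1r -[RHS](scaler0 _ 4) -[0](subrr (0 : A)) -{1}E1 -E2.
  by module_field.
have x10 : x1 = 0 by rewrite -E1 xh0 scaler0 addr0.
by move: E; rewrite xh0 x10 add0r addr0 => ->.
Qed.

(** The products are read off from the Peirce components, with respect to [a], of two equations: the
    idempotence of [b] and the primitivity of [b] applied to [a]. *)
Lemma two_generated_table (a b : A) :
  primitive_jhalf_axis a -> primitive_jhalf_axis b -> a <> b ->
  exists phi h b0, [/\ peirce_table phi a h b0, b = phi *: a + h + b0,
    h = 4 *: (a ** b - a ** (a ** b)) & h = 0 -> phi = 0].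
Proof.
move=> [axa linea] [axb lineb] neq_ab.
have [a0 aa] : nz_idempotent a by case: axa.
have [_ bb] : nz_idempotent b by case: axb.
have [|j1a _ _] := (axis_identitiesP two0 _).1 axa; first by case: axa.
have [|j1b _ _] := (axis_identitiesP two0 _).1 axb; first by case: axb.
have [_ _ fu] := axa.
have [b1 [b0 [h [ab1 ab0 ah bE]]]] := peirce_ex two0 b j1a.
have [phi _ b1E] : line a b1 by rewrite -linea /eigen /= scale1r.
have eh : eigen a 2^-1 h by [].
have e0 : eigen a 0 b0 by rewrite /eigen /= scale0r.
have a00 : a ** (b0 ** b0) = 0.
  by rewrite -[RHS](scale0r (b0 ** b0)); apply: (fusion00 fu);
    exists b0 => //; exists b0.
have a0h : a ** (b0 ** h) = 2^-1 *: (b0 ** h).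
  by apply: (fusion0h fu); exists b0 => //; exists h.
have [u eu [v ev hh]] : sumset (eigen a 1) (eigen a 0) (h ** h).
  by apply: (fusionhh fu); exists h => //; exists h.
have au : a ** u = u by rewrite [LHS]eu scale1r.
have av : a ** v = 0 by rewrite [LHS]ev scale0r.
have {}bE : b = phi *: a + h + b0 by rewrite bE -b1E addrAC.
have hE : h = 4 *: (a ** b - a ** (a ** b)).
  rewrite bE; do 2![amul_expand; rewrite ?aa ?ah ?ab0].
  by amul_expand; module_field.
(* These are the components of [b ** b - b]. *)
have [E1 E0 Eh] : [/\ phi ^+ 2 *: a + u - phi *: a = 0, b0 ** b0 + v - b0 = 0
    & phi *: h + 2 *: (b0 ** h) - h = 0].
  apply: (peirce_eq0 (a := a)).
  - by amul_expand; rewrite aa au.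
  - by amul_expand; rewrite a00 av ab0 subr0 addr0.
  - by amul_expand; rewrite a0h ah; module_ring.
  - transitivity (b ** b - b); last by rewrite bb subrr.
    rewrite bE; amul_expand; rewrite (amulC h a) (amulC b0 a) (amulC h b0).
    rewrite aa ah ab0 -hh.
    by amul_expand; module_field.
have uE : u = (phi * (1 - phi)) *: a.
  by apply/eqP; rewrite -subr_eq0 -[X in _ == X]E1; apply/eqP; module_ring.
have vE : v = b0 - b0 ** b0.
  by apply/eqP; rewrite -subr_eq0 -[X in _ == X]E0; apply/eqP; module_ring.
have {E1 E0} hh : h ** h = (phi * (1 - phi)) *: a + (b0 - b0 ** b0).
  by rewrite -hh uE vE.
have {Eh} zh : b0 ** h = ((1 - phi) / 2) *: h.
  apply/eqP; rewrite -subr_eq0; apply/eqP.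
  rewrite -[RHS](scaler0 _ 2^-1) -Eh.
  by module_field.
(* This is the component of [a] in [A_1(b)], a multiple of [b] by primitivity. *)
have [psi _ psiE] : line b (2 *: (b ** (b ** a)) - b ** a).
  rewrite -lineb /eigen /= scale1r.
  apply/eqP; rewrite -subr_eq0 -[X in _ == X](j1b a) /cubic_defect; apply/eqP.
  by amul_expand; module_ring.
have [F1 F0 Fh] : [/\ (phi ^+ 2 - psi * phi) *: a = 0,
    b0 - b0 ** b0 - psi *: b0 = 0 & (phi - psi) *: h = 0].
  apply: (peirce_eq0 (a := a)).
  - by amul_expand; rewrite aa.
  - by amul_expand; rewrite a00 ab0 scaler0 !subr0.
  - by amul_expand; rewrite ah; module_ring.
  - have baE : b ** a = phi *: a + 2^-1 *: h.
      by rewrite bE; amul_expand; rewrite (amulC h) (amulC b0) aa ah ab0 addr0.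
    transitivity (2 *: (b ** (b ** a)) - b ** a - psi *: b); last first.
      by rewrite psiE subrr.
    rewrite baE bE; amul_expand; rewrite (amulC h a) (amulC b0 a).
    rewrite aa ah ab0 hh zh.
    by module_field.
exists phi, h, b0.
(* If [h = 0] then [phi] is 0 or 1, and [phi = 1] forces [b0 = 0], so [b = a]. Otherwise the half
   component gives [psi = phi], and the zero component gives [b0 ** b0]. *)
have [h0|h0] := eqVneq h 0.
  have [G1 G0 _] : [/\ (phi * (1 - phi)) *: a = 0, b0 - b0 ** b0 = 0
      & 0 = 0 :> A].
    apply: (peirce_eq0 (a := a)).
    - by amul_expand; rewrite aa.
    - by amul_expand; rewrite ab0 a00 subr0.
    - by rewrite amul0r scaler0.
    - by rewrite -hh h0 amul0r addr0.
  have b00 : b0 ** b0 = b0 by apply/eqP; rewrite eq_sym -subr_eq0 G0.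
  have phi0 : phi = 0.
    move/eqP: G1; rewrite scaler_eq0 (negPf a0) orbF mulf_eq0 => /orP[/eqP//|].
    rewrite subr_eq0 => /eqP phi1; case: neq_ab.
    move/eqP: F1; rewrite scaler_eq0 (negPf a0) orbF -phi1 expr1n mulr1.
    rewrite subr_eq0 => /eqP psi1; move/eqP: F0.
    rewrite b00 subrr sub0r -psi1 scale1r oppr_eq0 => /eqP b0_0.
    by rewrite bE -phi1 h0 b0_0 scale1r !addr0.
  split=> //; split=> //; rewrite phi0 ?h0 ?amul0r ?scaler0 //.
    by rewrite mul0r !scale0r addr0.
  by rewrite subr0 scale1r.
have phipsi : psi = phi.
  by move/eqP: Fh; rewrite scaler_eq0 (negPf h0) orbF subr_eq0 => /eqP.
have b00 : b0 ** b0 = (1 - phi) *: b0.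
  apply/eqP; rewrite -subr_eq0 -oppr_eq0 -[X in _ == X]F0 phipsi; apply/eqP.
  by module_ring.
split=> //; first split=> //; last by move=> hz; rewrite hz eqxx in h0.
by rewrite hh b00; module_ring.
Qed.

End TwoGenerated.

(** * Miyamoto involutions *)

Section Miyamoto.
Context {K : fieldType} {A : comNAAlgType K}.
Hypothesis two0 : (2 : K) != 0.
Implicit Types (c x y : A).

(* Locked, since otherwise rewriting with [miyamotoD] would see it as a sum. *)
Definition miyamoto c x : A := locked (2 *: even_part c 1 x - x).

Lemma miyamotoE c x : miyamoto c x = 2 *: even_part c 1 x - x.
Proof. by rewrite /miyamoto -lock. Qed.

Lemma miyamotoD c x y : miyamoto c (x + y) = miyamoto c x + miyamoto c y.
Proof. by rewrite !miyamotoE /even_part; amul_expand; module_ring. Qed.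

Lemma miyamotoZ c (k : K) x : miyamoto c (k *: x) = k *: miyamoto c x.
Proof. by rewrite !miyamotoE /even_part; amul_expand; module_ring. Qed.

Lemma miyamotoN c x : miyamoto c (- x) = - miyamoto c x.
Proof. by rewrite -scaleN1r miyamotoZ scaleN1r. Qed.

Lemma miyamoto0 c : miyamoto c 0 = 0.
Proof. by have := miyamotoZ c 0 0; rewrite !scale0r. Qed.

Lemma miyamoto_half c x : c ** x = 2^-1 *: x -> miyamoto c x = - x.
Proof.
by move=> cx; rewrite miyamotoE even_part_half // scaler0 sub0r.
Qed.

Lemma miyamoto_even c x : c ** (c ** x) = c ** x -> miyamoto c x = x.
Proof. by move=> cx; rewrite miyamotoE even_part_id //; module_ring. Qed.

Variable c : A.
Hypothesis axc : axis_identities c 1.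

Lemma miyamotoK : involutive (miyamoto c).
Proof.
move=> x; have [x1 [x0 [xh [c1 c0 ch ->]]]] := peirce_ex two0 x (cubic0 axc).
have m1 : miyamoto c x1 = x1 by rewrite miyamoto_even // !c1.
have m0 : miyamoto c x0 = x0 by rewrite miyamoto_even // !c0 amul0r.
have mh := miyamoto_half ch.
rewrite !miyamotoD !m1 !m0.
by rewrite mh miyamotoN mh opprK.
Qed.

Lemma miyamotoM x y : miyamoto c (x ** y) = miyamoto c x ** miyamoto c y.
Proof.
apply/eqP; rewrite -subr_eq0; apply/eqP.
rewrite -[RHS](scaler0 _ 2) -(grading0 axc x y) !miyamotoE /grading_defect.
by amul_expand; module_ring.
Qed.

(** [miyamoto c] is an involutive automorphism, so it carries defects to defects. *)
Lemma axis_identities_miyamoto x :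
  axis_identities x 1 -> axis_identities (miyamoto c x) 1.
Proof.
have evM u v : even_part (miyamoto c u) 1 v
    = miyamoto c (even_part u 1 (miyamoto c v)).
  rewrite /even_part !(miyamotoD, miyamotoN, miyamotoZ).
  by rewrite !miyamotoM miyamotoK.
move=> [j1 j2 j3]; split=> [y|y z|y z].
- rewrite -[RHS](miyamoto0 c) -(j1 (miyamoto c y)) /cubic_defect.
  by rewrite !(miyamotoD, miyamotoN, miyamotoZ) !miyamotoM miyamotoK.
- rewrite -[RHS](miyamoto0 c) -(j2 (miyamoto c y) (miyamoto c z)).
  rewrite /seress_defect !evM; move: (even_part x 1 _) => e.
  by rewrite !(miyamotoD, miyamotoN) !miyamotoM !miyamotoK.
- rewrite -[RHS](miyamoto0 c) -(j3 (miyamoto c y) (miyamoto c z)).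
  rewrite /grading_defect !evM (miyamotoM y z).
  move: (even_part x 1 (miyamoto c y)) (even_part x 1 (miyamoto c z)) => e f.
  move: (even_part x 1 _) => g.
  by rewrite !(miyamotoD, miyamotoN, miyamotoZ) !miyamotoM !miyamotoK.
Qed.

End Miyamoto.

(** * The associator and the curve of primitive idempotents in terms of the table *)

Section Associator.
Context {K : fieldType} {A : comNAAlgType K}.

Lemma associator_is_linear (a b : A) : linear (associator a b).
Proof. by move=> k x y; rewrite /associator; amul_expand; module_ring. Qed.

End Associator.

Ltac table_expand tab :=
  let tabE := constr:((tab_aa tab, tab_ah tab, tab_a0 tab, tab_hh tab,
                       tab_0h tab, tab_00 tab)) in
  match type of tab with peirce_table _ ?a ?h ?b0 =>
    do 3?[amul_expand; rewrite ?(amulC h a, amulC b0 a, amulC h b0, tabE)];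
    amul_expand
  end.

Section Table.
Context {K : fieldType} {A : comNAAlgType K}.
Variables (phi : K) (a h b0 : A).
Hypotheses (two0 : (2 : K) != 0) (tab : peirce_table phi a h b0).
Local Notation q := (phi * (1 - phi)).
Local Notation b := (phi *: a + h + b0).

Lemma associator_a : associator a b a = - (4^-1 *: h).
Proof.
have four0 : (4 : K) != 0 by rewrite (_ : 4 = 2 * 2) ?mulf_neq0 //; ring.
by rewrite /associator; table_expand tab; module_field; rewrite two0 four0.
Qed.

Lemma associator_h : associator a b h = 2^-1 *: (q *: a - phi *: b0).
Proof. by rewrite /associator; table_expand tab; module_field. Qed.

Lemma associator_b0 : associator a b b0 = ((1 - phi) / 4) *: h.
Proof.
have four0 : (4 : K) != 0 by rewrite (_ : 4 = 2 * 2) ?mulf_neq0 //; ring.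
by rewrite /associator; table_expand tab; module_field; rewrite two0 four0.
Qed.

Local Notation n t := (a + t *: h + t ^+ 2 *: (phi *: b0)).
Local Notation N t := (1 + q * t ^+ 2).

(** The last conclusion is not [z = 0] because [b0] may vanish when [phi = 1]. *)
Lemma peirce_free x y z : a != 0 -> h != 0 ->
  x *: a + y *: h + z *: b0 = 0 -> [/\ x = 0, y = 0 & z *: b0 = 0].
Proof.
move=> a0 h0 E; have [||||xa zb yh] := @peirce_eq0 _ _ two0 a (x *: a) (z *:
  b0) (y *: h).
- by rewrite amulZr (tab_aa tab).
- by rewrite amulZr (tab_a0 tab) scaler0.
- by rewrite amulZr (tab_ah tab) scalerC.
- by rewrite addrAC.
split=> //; first by apply/eqP; move/eqP: xa;
  rewrite scaler_eq0 (negPf a0) orbF.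
by apply/eqP; move/eqP: yh; rewrite scaler_eq0 (negPf h0) orbF.
Qed.

Lemma curve_mul t x y z : n t ** (x *: a + y *: h + z *: b0) =
  (x + t * y * q) *: a
  + ((y + t * x + t * z * (1 - phi) + q * t ^+ 2 * y) / 2) *: h
  + (phi * t * y + q * t ^+ 2 * z) *: b0.
Proof. by table_expand tab; module_field. Qed.

Lemma curve_idempotent t : a != 0 -> h != 0 -> N t != 0 ->
  nz_idempotent ((N t)^-1 *: n t).
Proof.
move=> a0 h0 N0; split.
  rewrite scaler_eq0 invr_eq0 (negPf N0) /=; apply/eqP => nt.
  have [|/eqP] := @peirce_free 1 t (t ^+ 2 * phi) a0 h0;
    last by rewrite oner_eq0.
  by rewrite scale1r -scalerA.
have nn : n t ** n t = N t *: n t.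
  have {2}-> : n t = 1 *: a + t *: h + (t ^+ 2 * phi) *: b0.
    by rewrite scale1r scalerA.
  rewrite curve_mul.
  by module_field.
by rewrite amulZl amulZr nn !scalerA mulVf ?mulr1.
Qed.

(** Comparing coefficients gives [y = t x] and [z b0 = phi t y b0], whence [v = x n(t)]. *)
Lemma curve_primitive t x y z : a != 0 -> h != 0 -> N t != 0 ->
  let v := x *: a + y *: h + z *: b0 in
  ((N t)^-1 *: n t) ** v = v -> v = (N t * x) *: ((N t)^-1 *: n t).
Proof.
move=> a0 h0 N0 v cv.
have nv : n t ** v = N t *: v.
  by rewrite -[v in RHS]cv amulZl (scalerA (N t)) mulfV // scale1r.
have [E1 E2 E3] : [/\ x + t * y * q - N t * x = 0,
    (y + t * x + t * z * (1 - phi) + q * t ^+ 2 * y) / 2 - N t * y = 0 &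
    (phi * t * y + q * t ^+ 2 * z - N t * z) *: b0 = 0].
  apply: (peirce_free a0 h0).
  transitivity (n t ** v - N t *: v); last by rewrite nv subrr.
  by rewrite /v curve_mul; module_ring.
have {}E2 : y * (1 + q * t ^+ 2) = t * (x + z * (1 - phi)).
  apply/eqP; rewrite -subr_eq0 -oppr_eq0 -[X in _ == X](mulr0 2) -E2.
  by apply/eqP; field.
rewrite (scalerA (N t * x)) mulrAC mulfV // mul1r.
have zE : z *: b0 = (phi * t * y) *: b0.
  by apply/eqP; rewrite -subr_eq0 -[X in _ == X]oppr0 -E3; apply/eqP;
    module_ring.
(* If [b0 = 0], then [z] is undetermined, but [b0 ** h = 0] forces [phi = 1]. *)
have [b00|b00] := eqVneq b0 0.
  have phi1 : phi = 1.
    move/eqP: (tab_0h tab);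
      rewrite b00 amul0l eq_sym scaler_eq0 (negPf h0) orbF.
    by rewrite mulf_eq0 invr_eq0 (negPf two0) orbF subr_eq0 => /eqP.
  have yE : y = t * x.
    by rewrite -[LHS]mulr1; move: E2; rewrite phi1 subrr !(mulr0, mul0r, addr0).
  by rewrite /v yE b00; module_ring.
have {}zE : z = phi * t * y.
  apply/eqP; rewrite -subr_eq0; move/eqP: zE; rewrite -subr_eq0 -scalerBl.
  by rewrite scaler_eq0 (negPf b00) orbF.
have yE : y = t * x.
  apply/eqP; rewrite -subr_eq0; apply/eqP.
  have -> : y - t * x = y * (1 + q * t ^+ 2) - t * (x + z * (1 - phi)).
    by rewrite zE; ring.
  by rewrite E2 subrr.
by rewrite /v zE yE; module_ring.
Qed.

End Table.

(** * Solidity over an algebraically closed field *)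

Section Line.
Context {K : closedFieldType} {A : comNAAlgType K}.
Variables (phi : K) (a h b0 : A).
Hypotheses (two0 : (2 : K) != 0) (tab : peirce_table phi a h b0).
Local Notation q := (phi * (1 - phi)).
Local Notation b := (phi *: a + h + b0).
Local Notation D := (associator a b).
Local Notation n t := (a + t *: h + t ^+ 2 *: (phi *: b0)).
Local Notation N t := (1 + q * t ^+ 2).
Local Notation S := (even_part a 1).
Hypothesis axa : axis_identities a 1.

Lemma seress_comm u y : S u = u -> a ** (u ** y) = u ** (a ** y).
Proof.
move=> Su; apply/eqP; rewrite -subr_eq0 -(seress0 axa u y) /seress_defect.
by rewrite Su.
Qed.

(** [L_a] commutes with itself and, by the Seress identity, with [L_b0]. *)
Lemma associator_half x : D x = a ** (h ** x) - h ** (a ** x).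
Proof.
have := seress_comm x (even_part_id (_ : a ** (a ** b0) = a ** b0)).
rewrite (tab_a0 tab) amul0r => /(_ erefl) E.
by rewrite /associator; amul_expand; rewrite E; module_ring.
Qed.

Local Notation S' x := (4 *: (h ** (a ** x) + a ** (h ** x) - h ** x)).

(** [S'] is the derivative at 0 of the even part along the curve. On even [x] it is [- 4 D x],
    because [a] acts on [h ** x] as 1/2; on [A_{1/2}(a)] it is [4 D x], and [miyamoto a] changes the
    sign. *)
Lemma even_part'_miyamoto x : S' (miyamoto a x) = - (4 *: D x).
Proof.
have [x1 [x0 [xh [c1 c0 ch ->]]]] := peirce_ex two0 x (cubic0 axa).
rewrite !miyamotoD (miyamoto_half two0 ch) !associator_half.
rewrite !miyamoto_even ?c1 ?c0 ?amul0r //.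
have E1 : a ** (h ** x1) = 2^-1 *: (h ** x1).
  rewrite (amulC h) seress_comm ?(tab_ah tab) ?amulZr //.
  by apply: even_part_id; rewrite !c1.
have E0 : a ** (h ** x0) = 2^-1 *: (h ** x0).
  rewrite (amulC h) seress_comm ?(tab_ah tab) ?amulZr //.
  by apply: even_part_id; rewrite !c0 amul0r.
amul_expand; rewrite E1 E0 c1 c0 ch; amul_expand.
by module_field.
Qed.

(* The derivative at [t = 0] of the Miyamoto automorphism of [n t], composed
   with that of [a], is a multiple of [D]. *)
Lemma derivation_of_axes :
  (forall t, N t != 0 -> axis_identities (n t) (N t)) -> derivation D.
Proof.
move=> axn; split=> [|x y]; first exact: associator_is_linear.
have Sev (u : A) : exists2 e', polyfun 4 (fun t => even_part (n t) (N t) u) e' &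
    e' 0 = S' u.
  have [e' eP e0] := polyfun_even_part q a h (phi *: b0) (polyfun_cst u).
  by exists e' => //; rewrite e0 /even_part; amul_expand; module_ring.
have key u v : S' (u ** v) = S' u ** miyamoto a v + miyamoto a u ** S' v.
  have [e eP e0] := Sev (u ** v).
  have [f fP f0] := Sev u; have [g gP g0] := Sev v.
  have uP := polyfun_cst u; have vP := polyfun_cst v.
  have := polyfunD (polyfunD (polyfunN q (polyfunN q eP))
      (polyfunZc (-2) (polyfun_amul fP gP)))
    (polyfunD (polyfunN q (polyfunN q
       (polyfunD (polyfun_amul fP vP) (polyfun_amul uP gP))))
     (polyfunZc (-1) (polyfunN q (polyfunN q (polyfunN q (polyfunN q
       (polyfun_amul uP vP))))))).
  move=> GP.
  have rE t : (1 + q *: 'X^2 : {poly K}).[t] = N t.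
    by rewrite hornerD hornerZ hornerXn hornerC.
  have r0 : 1 + q *: 'X^2 != 0 :> {poly K}.
    apply: contra (oner_neq0 K) => /eqP r0; have := rE 0.
    by rewrite r0 horner0 expr0n mulr0 addr0 => <-.
  (* The grading identity holds wherever [N] is nonzero, so its derivative at 0 vanishes too. *)
  have [t|_] := polyfun_eq0 r0 GP _ 0.
    rewrite rE => Nt.
    rewrite -[RHS](grading0 (axn t Nt) u v) /grading_defect.
    by module_ring.
  rewrite !(mulr0, scale0r, addr0, add0r, expr0n) /= => E.
  apply/eqP; rewrite -subr_eq0 -[X in _ == X]E -e0 -f0 -g0; apply/eqP.
  by rewrite !miyamotoE; amul_expand; module_ring.
have four0 : (4 : K) != 0 by rewrite (_ : 4 = 2 * 2) ?mulf_neq0 //; ring.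
(* Precomposed with the automorphism [miyamoto a], the twisted Leibniz rule [key] becomes the
   ordinary one for [- 4 D]. *)
have := key (miyamoto a x) (miyamoto a y).
rewrite -(miyamotoM axa) !even_part'_miyamoto !(miyamotoK two0 axa).
move/(congr1 (fun u => - (4^-1 *: u))).
by rewrite amulNl amulNr amulZl amulZr -opprD -scalerDr !scalerN !opprK !scalerA
  mulVf // !scale1r.
Qed.

Hypothesis axb : axis_identities b 1.

Lemma miyamoto_a x y z :
  miyamoto a (x *: a + y *: h + z *: b0) = x *: a - y *: h + z *: b0.
Proof.
rewrite !miyamotoD !miyamotoZ (miyamoto_half two0 (tab_ah tab)) scalerN.
by rewrite !miyamoto_even ?(tab_a0 tab) ?(tab_aa tab) ?amul0r.
Qed.

Hypothesis derD : derivation D.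
Let lD : linear D. Proof. by case: derD. Qed.
Let DM : forall x y, D (x ** y) = D x ** y + x ** D y.
Proof. by case: derD. Qed.

Let four0 : (4 : K) != 0.
Proof. by rewrite (_ : 4 = 2 * 2) ?mulf_neq0 //; ring. Qed.

Lemma miyamoto_b : phi = 0 -> miyamoto b a = a - 2 *: h.
Proof.
move=> phi0; rewrite miyamotoE /even_part phi0.
table_expand tab; rewrite phi0.
by module_field.
Qed.

Lemma uniq_opp (x : K) : x != 0 -> uniq [:: 0; x; - x].
Proof.
move=> x0; rewrite /= !inE negb_or [0 == x]eq_sym [0 == - x]eq_sym oppr_eq0 x0.
by rewrite /= andbT -subr_eq0 opprK -mulr2n -mulr_natl mulf_neq0.
Qed.

Let axb' : axis_identities (phi *: a - h + b0) 1.
Proof.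
have := axis_identities_miyamoto two0 axa axb.
by have := miyamoto_a phi 1 1; rewrite !scale1r => ->.
Qed.

Lemma curve_axes t : axis_identities (n t) (N t).
Proof.
have flow_n s :
    4 *: D (n s) = (2 * q * s) *: n s - N s *: (h + (2 * s) *: (phi *: b0)).
  rewrite !(flow_fieldD lD) !(flow_fieldZ lD).
  rewrite (associator_a two0 tab) (associator_h two0 tab)
    (associator_b0 two0 tab).
  by module_field; rewrite two0 four0.
have ax0 : N 0 != 0 /\ axis_identities (n 0) (N 0).
  by rewrite expr0n /= mulr0 !scale0r !addr0 oner_eq0.
(* For [phi = 0] the curve is the line [a + t h]. It meets [miyamoto b a] at [-2], and the image of
   that axis under [miyamoto a] at [2]. *)
have [phi0|phi0] := eqVneq phi 0.
  have ax2 := axis_identities_miyamoto two0 axb axa.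
  rewrite (miyamoto_b phi0) in ax2.
  have ax2' := axis_identities_miyamoto two0 axa ax2.
  apply: (axis_identities_curve lD DM flow_n (rs := [:: 0; 2; -2])) => //.
    exact: uniq_opp.
  have Nu u : N u = 1 by rewrite phi0 mul0r mul0r addr0.
  move=> u; rewrite !inE => /or3P[] /eqP -> //; split;
    rewrite ?Nu ?oner_neq0 //.
    have -> : n 2 = miyamoto a (a - 2 *: h); last exact: ax2'.
    have := miyamoto_a 1 (-2) 0; rewrite scale1r scale0r addr0 scaleNr => ->.
    by rewrite phi0; module_ring.
  have -> : n (-2) = a - 2 *: h; last exact: ax2.
  by rewrite phi0; module_ring.
(* At [phi^-1] the curve passes through a multiple of [b], at [- phi^-1] through the same multiple
   of [miyamoto a b]. *)
apply: (axis_identities_curve lD DM flow_n (rs := [:: 0; phi^-1;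
  - phi^-1])) => //.
  by rewrite uniq_opp // invr_eq0.
have Nu u : u ^+ 2 = phi^-1 ^+ 2 -> N u = phi^-1 * 1.
  by move=> ->; field.
move=> u; rewrite !inE => /or3P[] /eqP -> //; split.
- by rewrite Nu // mulr1 invr_eq0.
- have -> : n phi^-1 = phi^-1 *: b.
    by module_field.
  by rewrite Nu //; apply: axis_identitiesZ.
- by rewrite Nu ?sqrrN // mulr1 invr_eq0.
- have -> : n (- phi^-1) = phi^-1 *: (phi *: a - h + b0).
    by module_field.
  by rewrite Nu ?sqrrN //; apply: axis_identitiesZ.
Qed.

Local Notation a' := ((1 - phi)^-1 *: b0).
Local Notation n' t := (a' + t *: h + t ^+ 2 *: (q *: a)).

(* Up to the sign of [D], the curve through [a'] is the curve through [a]
   with [a] and [a'] exchanged; it is needed for [1 - a], the point at infinity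
   of the first curve, and when [phi = 0], where the two curves are disjoint. *)
Lemma complement_curve_axes t : phi != 1 -> axis_identities (n' t) (N t).
Proof.
move=> phi1; have {}phi1 : 1 - phi != 0 by rewrite subr_eq0 eq_sym.
have lD' : linear (fun x => - D x).
  by move=> k x y; rewrite lD opprD scalerN.
have DM' x y : - D (x ** y) = (- D x) ** y + x ** (- D y).
  by rewrite DM amulNl amulNr opprD.
have flow_n s :
    4 *: (- D (n' s)) = (2 * q * s) *: n' s - N s *: (h + (2 * s) *: (q *: a)).
  rewrite !(flow_fieldD lD) !(flow_fieldZ lD).
  rewrite (associator_a two0 tab) (associator_h two0 tab)
    (associator_b0 two0 tab).
  module_field.
  by rewrite two0 four0 phi1.
have [phi0|phi0] := eqVneq phi 0.
  have Nu u : N u = 1 by rewrite phi0 mul0r mul0r addr0.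
  (* Here [n' t = b0 + t h]. The parameters 1 and -1 give [b] and [miyamoto a b]; [miyamoto b]
     reflects -1 in 1, giving 3. They differ by powers of 2 up to sign, hence are distinct. *)
  apply: (axis_identities_curve lD' DM' flow_n (rs := [:: 1; -1; 3])) => //.
    rewrite /= !inE negb_or andbT -!(subr_eq0 1) -(subr_eq0 (-1)) opprK.
    rewrite -opprD oppr_eq0 (_ : 1 - 3 = - 2); last by ring.
    rewrite (_ : 1 + 3 = 4); last by ring.
    by rewrite (_ : 1 + 1 = 2) ?oppr_eq0 ?two0 ?four0 //; ring.
  move=> u; rewrite !inE => /or3P[] /eqP ->; split; rewrite ?Nu ?oner_neq0 //.
  - have -> : n' 1 = b; last exact: axb.
    by rewrite phi0 subr0 invr1; module_ring.
  - have -> : n' (-1) = phi *: a - h + b0; last exact: axb'.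
    by rewrite phi0 subr0 invr1; module_ring.
  have -> : n' 3 = miyamoto b (phi *: a - h + b0).
    rewrite miyamotoE /even_part phi0 subr0 invr1.
    table_expand tab; rewrite phi0.
    by module_field.
  exact: axis_identities_miyamoto.
have q0 : q != 0 by rewrite mulf_neq0.
(* Away from 0 the second curve reparametrizes the first: [n' s = q s^2 n (1 / (q s))], and likewise
   for [N]. *)
have axn' s : s != 0 -> axis_identities (n' s) (N s).
  move=> s0; have := axis_identitiesZ (q * s ^+ 2) (curve_axes (q * s)^-1).
  congr axis_identities; last by field; rewrite phi0 phi1 s0.
  module_field.
  by rewrite phi0 phi1 s0.
have ex_nonroot d : exists r, [/\ r != 0, N r != 0 & r ^+ 2 != d].
  have r0 : 1 + q *: 'X^2 != 0 :> {poly K}.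
    apply: contra (oner_neq0 K) => /eqP E.
    have := congr1 (fun p : {poly K} => p.[0]) E.
    by rewrite hornerD hornerZ hornerXn hornerC expr0n mulr0 addr0 horner0 =>
      ->.
  have /closed_nonrootP[r] : 'X * (1 + q *: 'X^2) * ('X^2 - d%:P) != 0 :> {poly
    K}.
    by rewrite !mulf_neq0 ?polyX_eq0 // monic_neq0 // monicXnsubC.
  rewrite rootE !hornerM !hornerD hornerN hornerZ !hornerXn !hornerC hornerX.
  by rewrite !mulf_eq0 !negb_or subr_eq0 => /andP[/andP[? ?] ?]; exists r.
have [r [r0 Nr _]] := ex_nonroot 0.
have [s [s0 Ns sr]] := ex_nonroot (r ^+ 2).
(* Three distinct nonzero parameters off the zeros of [N] suffice to reach [t = 0] as well. *)
apply: (axis_identities_curve lD' DM' flow_n (rs := [:: s; r; - r])) => //.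
  rewrite /= !inE negb_or andbT; apply/andP; split.
    by rewrite -negb_or -eqf_sqr.
  by have := uniq_opp r0; rewrite /= !inE => /and3P[].
move=> u; rewrite !inE => /or3P[] /eqP ->; split=> //; try exact: axn'.
  by rewrite sqrrN.
by apply: axn'; rewrite oppr_eq0.
Qed.

(** The coefficients of [c ** c = c] are solved for [x], [y], [z]. For [x] nonzero, [c] lies on the
    first curve at [t = y / x]; for [x = 0] it lies on the second at [t = y]. *)
Lemma primitive_on_curves x y z (c := x *: a + y *: h + z *: b0) :
    a != 0 -> h != 0 -> c != 0 -> c ** c = c ->
    (c ** a = a -> exists k, a = k *: c) ->
  (exists2 t, N t != 0 & c = (N t)^-1 *: n t) \/
  (phi != 1 /\ exists2 t, N t != 0 & c = (N t)^-1 *: n' t).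
Proof.
move=> a0 h0 c0 cc ca.
have [E1 E2 E3] : [/\ x ^+ 2 + q * y ^+ 2 - x = 0,
    y * (x + z * (1 - phi)) - y = 0 &
    (phi * y ^+ 2 + z ^+ 2 * (1 - phi) - z) *: b0 = 0].
  apply: (peirce_free two0 tab a0 h0).
  transitivity (c ** c - c); last by rewrite cc subrr.
  by rewrite /c; table_expand tab; module_field.
have [phi1|phi1] := eqVneq phi 1.
  left; exists y; first by rewrite phi1 subrr mulr0 mul0r addr0 oner_neq0.
  have x1 : x = 1.
    have : x * (x - 1) = 0.
      by rewrite -[RHS]E1 phi1; ring.
    move/eqP; rewrite mulf_eq0 subr_eq0 => /orP[]/eqP // x0.
    case/negP: c0; have y0 : y = 0.
      by apply/eqP; rewrite -oppr_eq0 -[X in _ == X]E2 x0 phi1; apply/eqP; ring.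
    have cE : c = z *: b0 by rewrite /c x0 y0; module_ring.
    rewrite -cc cE amulZl amulZr (tab_00 tab) phi1.
    by rewrite subrr !(scale0r, scaler0).
  have zE : z *: b0 = (y ^+ 2) *: b0.
    apply/eqP; rewrite -subr_eq0 -oppr_eq0 -[X in _ == X]E3 phi1; apply/eqP.
    by module_ring.
  by rewrite /c zE x1 phi1 subrr mulr0 mul0r addr0 invr1 !scale1r.
have {}phi1' : 1 - phi != 0 by rewrite subr_eq0 eq_sym.
have b00 : b0 != 0.
  apply: contra h0 => /eqP b00; have /eqP := tab_0h tab.
  rewrite b00 amul0l eq_sym scaler_eq0 mulf_eq0 (negPf phi1') invr_eq0.
  by rewrite (negPf two0).
have {}E3 : phi * y ^+ 2 + z ^+ 2 * (1 - phi) - z = 0.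
  by move/eqP: E3; rewrite scaler_eq0 (negPf b00) orbF => /eqP.
have [x0|x0] := eqVneq x 0.
  right; split=> //; exists y.
    by move: E1; rewrite x0 expr0n add0r subr0 => ->; rewrite addr0 oner_neq0.
  have qy : q * y ^+ 2 = 0 by rewrite -[RHS]E1 x0; ring.
  have : (z * (1 - phi)) * (z * (1 - phi) - 1) = 0.
    rewrite -[RHS](mul0r (1 - phi)) -E3 -[LHS]add0r -qy; ring.
  move/eqP; rewrite mulf_eq0 [in X in _ || X]subr_eq0 => /orP[]/eqP z1.
    case/eqP: c0; have z0 : z = 0.
      by apply: (mulIf phi1'); rewrite mul0r.
    have y0 : y = 0.
      by apply/eqP; rewrite -oppr_eq0 -[X in _ == X]E2 x0 z0; apply/eqP; ring.
    by rewrite /c x0 y0 z0 !scale0r !addr0.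
  have zE : z = (1 - phi)^-1 by rewrite -[LHS](mulfK phi1') z1 mul1r.
  rewrite qy addr0 invr1 scale1r (scalerA (y ^+ 2)) mulrC qy scale0r addr0.
  by rewrite /c x0 zE scale0r add0r addrC.
have NE : N (y / x) = x^-1.
  have qy : q * y ^+ 2 = x - x ^+ 2 by rewrite -[RHS]addr0 -E1; ring.
  by rewrite expr_div_n mulrA qy; field.
left; exists (y / x); rewrite NE ?invr_eq0 // invrK.
have xz : phi * y ^+ 2 = x * z.
  have [y0|y0] := eqVneq y 0; last first.
    have xz1 : x + z * (1 - phi) = 1.
      apply: (mulfI y0); rewrite mulr1; apply/eqP; rewrite -subr_eq0; exact/eqP.
    have zE : z = (1 - x) / (1 - phi).
      by apply: (mulIf phi1'); rewrite mulfVK // -[X in _ = X - x]xz1; ring.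
    apply: (mulIf phi1'); rewrite zE.
    have -> : phi * y ^+ 2 * (1 - phi) = x - x ^+ 2.
      by rewrite -[RHS]addr0 -E1; ring.
    by field.
  have x1 : x = 1.
    apply: (mulfI x0); rewrite mulr1; apply/eqP;
      rewrite -subr_eq0 -[X in _ == X]E1 y0.
    by apply/eqP; ring.
  (* Without this condition [c] could also be [a + (1 - phi)^-1 b0], the identity of the span, which
     is not primitive. *)
  have [k ak] : exists k, a = k *: c.
    apply: ca; rewrite /c x1 y0 scale0r addr0 scale1r; amul_expand.
    by rewrite (amulC b0) (tab_aa tab) (tab_a0 tab) scaler0 addr0.
  have [k1 _ /eqP] : [/\ 1 - k * x = 0, - (k * y) = 0 & (- (k * z)) *: b0 = 0].
    apply: (peirce_free two0 tab a0 h0).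
    transitivity (a - k *: c); last by rewrite -ak subrr.
    by rewrite /c; module_ring.
  rewrite scaler_eq0 (negPf b00) orbF oppr_eq0 mulf_eq0 => /orP[]/eqP kz.
    by move/eqP: k1; rewrite kz mul0r subr0 oner_eq0.
  by rewrite kz y0; ring.
rewrite /c; have zE : z = phi * y ^+ 2 / x by rewrite xz mulrC mulKf.
by rewrite zE; module_field.
Qed.

Lemma primitive_axis x y z (c := x *: a + y *: h + z *: b0) :
    a != 0 -> h != 0 -> nz_idempotent c ->
    (c ** a = a -> exists k, a = k *: c) -> jhalf_axis c.
Proof.
move=> a0 h0 [c0 cc] ca; apply/(axis_identitiesP two0) => //.
rewrite /c; have [[t Nt ->]|[phi1 [t Nt ->]]] :=
  primitive_on_curves a0 h0 c0 cc ca.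
  by apply: (axis_identitiesV _ Nt).1; apply: curve_axes.
by apply: (axis_identitiesV _ Nt).1; apply: complement_curve_axes.
Qed.

End Line.

(** * Extension of scalars *)

Section BaseChange.
Context {F E : fieldType} (iota : {rmorphism F -> E}) (A : comNAAlgType F).
Local Notation AE := (scalext iota A).
Local Notation P x := (pure iota x 1 : AE).
Implicit Types (x y a b : A) (u v : AE).

Lemma pureD x y : P (x + y) = P x + P y.
Proof. by have := pure1_ext_linear iota 1 x y; rewrite /= rmorph1 !scale1r. Qed.

Lemma pure0 : P 0 = 0.
Proof. by apply: (addrI (P 0)); rewrite -pureD !addr0. Qed.

Lemma pureZ k x : P (k *: x) = iota k *: P x.
Proof.
by have := pure1_ext_linear iota k x 0; rewrite /= pure0 !addr0.
Qed.

Lemma pureN x : P (- x) = - P x.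
Proof. by rewrite -scaleN1r pureZ rmorphN1 scaleN1r. Qed.

Lemma pureM x y : P (x ** y) = P x ** P y.
Proof. by rewrite amul_pure mulr1. Qed.

(** A linear form with value 1 at [x] extends to an [E]-linear form on the tensor product. *)
Lemma pure_eq0 x : P x = 0 -> x = 0.
Proof.
move=> Px0; apply/eqP; apply: contraT => x0.
have [f lf fx1] := exists_linear_form x0.
pose g (y : A) : E^o := iota (f y).
have lg : ext_linear iota g.
  by move=> k y z; rewrite /g lf rmorphD rmorphM.
have /eqP := extendE x 1 lg.
by rewrite Px0 (extend0 lg) /g fx1 rmorph1 scale1r eq_sym oner_eq0.
Qed.

Lemma pure_inj x y : P x = P y -> x = y.
Proof.
move=> xy; apply/eqP; rewrite -subr_eq0; apply/eqP/pure_eq0.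
by rewrite pureD pureN xy subrr.
Qed.

Lemma scalext_ind (Q : AE -> Prop) :
  (forall u v, Q u -> Q v -> Q (u + v)) -> (forall e u, Q u -> Q (e *: u)) ->
  (forall x, Q (P x)) -> forall u, Q u.
Proof.
move=> QD QZ QP u; rewrite [u]scalext_sum_pure.
apply: (big_ind Q) => [|//|p _].
  by rewrite -(scale0r (P 0)); apply: QZ.
by rewrite -[p.2]mulr1 -scale_pure; apply: QZ.
Qed.

Let pureE := (pureD, pureN, pureZ, pureM).

Lemma pure_even_part a x : P (even_part a 1 x) = even_part (P a) 1 (P x).
Proof.
by rewrite /even_part !pureE !expr1n !mulr1 !rmorph1 !rmorph_nat.
Qed.

(** The defects are linear in each argument, so pure tensors suffice. *)
Lemma axis_identities_pure a :
  axis_identities a 1 -> axis_identities (P a) 1.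
Proof.
have evD u v : even_part (P a) 1 (u + v)
    = even_part (P a) 1 u + even_part (P a) 1 v.
  by rewrite /even_part; amul_expand; module_ring.
have evZ k u : even_part (P a) 1 (k *: u) = k *: even_part (P a) 1 u.
  by rewrite /even_part; amul_expand; module_ring.
move=> [j1 j2 j3]; split.
- apply: scalext_ind => [u v uE vE|e u uE|x].
  + transitivity (cubic_defect (P a) 1 u + cubic_defect (P a) 1 v).
      by rewrite /cubic_defect; amul_expand; module_ring.
    by rewrite uE vE addr0.
  + transitivity (e *: cubic_defect (P a) 1 u).
      by rewrite /cubic_defect; amul_expand; module_ring.
    by rewrite uE scaler0.
  + rewrite -[RHS]pure0 -(j1 x) /cubic_defect !pureE.
    by rewrite !expr1n !mulr1 !rmorph1 !rmorph_nat.
- move=> u v; move: u v; apply: scalext_ind => [u v uE vE w|e u uE w|x].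
  + transitivity (seress_defect (P a) 1 u w + seress_defect (P a) 1 v w).
      by rewrite /seress_defect evD; amul_expand; module_ring.
    by rewrite uE vE addr0.
  + transitivity (e *: seress_defect (P a) 1 u w).
      by rewrite /seress_defect evZ; amul_expand; module_ring.
    by rewrite uE scaler0.
  + apply: scalext_ind => [u v uE vE|e u uE|y].
    * transitivity (seress_defect (P a) 1 (P x) u + seress_defect (P a) 1 (P x)
        v).
        by rewrite /seress_defect; amul_expand; module_ring.
      by rewrite uE vE addr0.
    * transitivity (e *: seress_defect (P a) 1 (P x) u).
        by rewrite /seress_defect; amul_expand; module_ring.
      by rewrite uE scaler0.
    * rewrite -[RHS]pure0 -(j2 x y) /seress_defect -pure_even_part.
      by move: (even_part a 1 x) => e; rewrite !pureE.
- move=> u v; move: u v; apply: scalext_ind => [u v uE vE w|e u uE w|x].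
  + transitivity (grading_defect (P a) 1 u w + grading_defect (P a) 1 v w).
      rewrite /grading_defect amulDl !evD.
      move: (even_part (P a) 1 (u ** w)) (even_part (P a) 1 (v ** w))
        (even_part (P a) 1 u) (even_part (P a) 1 v) (even_part (P a) 1 w) => *.
      by amul_expand; module_ring.
    by rewrite uE vE addr0.
  + transitivity (e *: grading_defect (P a) 1 u w).
      rewrite /grading_defect amulZl !evZ.
      move: (even_part (P a) 1 (u ** w)) (even_part (P a) 1 u)
        (even_part (P a) 1 w) => *.
      by amul_expand; module_ring.
    by rewrite uE scaler0.
  + apply: scalext_ind => [u v uE vE|e u uE|y].
    * transitivity (grading_defect (P a) 1 (P x) u + grading_defect (P a) 1 (P
        x) v).
        rewrite /grading_defect amulDr !evD.
        move: (even_part (P a) 1 (P x ** u)) (even_part (P a) 1 (P x ** v))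
          (even_part (P a) 1 (P x)) (even_part (P a) 1 u) (even_part (P a) 1 v)
            => *.
        by amul_expand; module_ring.
      by rewrite uE vE addr0.
    * transitivity (e *: grading_defect (P a) 1 (P x) u).
        rewrite /grading_defect amulZr !evZ.
        move: (even_part (P a) 1 (P x ** u)) (even_part (P a) 1 (P x))
          (even_part (P a) 1 u) => *.
        by amul_expand; module_ring.
      by rewrite uE scaler0.
    * rewrite -[RHS]pure0 -(j3 x y) /grading_defect -pureM -!pure_even_part.
      move: (even_part a 1 (x ** y)) (even_part a 1 x) (even_part a 1 y).
      by move=> e f g; rewrite !pureE !expr1n !rmorph1 !rmorph_nat.
Qed.

Lemma pure_associator a b x :
  P (associator a b x) = associator (P a) (P b) (P x).
Proof. by rewrite /associator !pureE. Qed.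

(** The Leibniz rule ascends by bilinearity and descends by injectivity of [pure]. *)
Lemma derivation_pure a b :
  derivation (associator a b) <-> derivation (associator (P a) (P b)).
Proof.
split=> [[lD DM]|[_ DM]]; split; try exact: associator_is_linear; last first.
  move=> x y; apply: pure_inj.
  by rewrite pureD !pureM !pure_associator pureM DM.
have AD u v : associator (P a) (P b) (u + v)
    = associator (P a) (P b) u + associator (P a) (P b) v.
  by rewrite /associator; amul_expand; module_ring.
have AZ k u : associator (P a) (P b) (k *: u) = k *: associator (P a) (P b) u.
  by rewrite /associator; amul_expand; module_ring.
move=> u v; move: u v; apply: scalext_ind => [u v uE vE w|e u uE w|x].
- by rewrite amulDl !AD uE vE; amul_expand; module_ring.
- by rewrite amulZl !AZ uE; amul_expand; module_ring.
- apply: scalext_ind => [u v uE vE|e u uE|y].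
  + by rewrite amulDr !AD uE vE; amul_expand; module_ring.
  + by rewrite amulZr !AZ uE; amul_expand; module_ring.
  + by rewrite -pureM -!pure_associator DM pureD !pureM.
Qed.

Lemma peirce_table_pure phi a h b0 :
  peirce_table phi a h b0 -> peirce_table (iota phi) (P a) (P h) (P b0).
Proof.
move=> [aa ah a0 hh zh zz]; split.
- by rewrite -pureM aa.
- by rewrite -pureM ah pureZ fmorphV rmorph_nat.
- by rewrite -pureM a0 pure0.
- by rewrite -pureM hh !pureE rmorphM rmorphB rmorph1.
- by rewrite -pureM zh pureZ rmorphM rmorphB rmorph1 fmorphV rmorph_nat.
- by rewrite -pureM zz pureZ rmorphB rmorph1.
Qed.

(** The table closes the span under products; conversely [h] is a polynomial in [L_a] applied to
    [b], and [b0] is then a difference. *)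
Lemma gen_subalgebra_table phi a h b0 (b := phi *: a + h + b0) :
    peirce_table phi a h b0 -> h = 4 *: (a ** b - a ** (a ** b)) ->
  gen_subalgebra [set a; b] =
  [set x | exists k : F * F * F, x = k.1.1 *: a + k.1.2 *: h + k.2 *: b0].
Proof.
move=> tab hE; apply/seteqP; split.
  move=> x; apply; split; last first.
    move=> _ [->|->].
      by exists (1, 0, 0); rewrite /= scale1r !scale0r !addr0.
    by exists (phi, 1, 1); rewrite /= !scale1r.
  split.
  - by exists (0, 0, 0); rewrite /= !scale0r !addr0.
  - move=> _ _ [[[k l] m] /= ->] [[[k' l'] m'] /= ->].
    by exists (k + k', l + l', m + m'); rewrite /=; module_ring.
  - move=> c _ [[[k l] m] /= ->].
    by exists (c * k, c * l, c * m); rewrite /=; module_ring.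
  - move=> _ _ [[[k l] m] /= ->] [[[k' l'] m'] /= ->].
    exists (k * k' + l * l' * (phi * (1 - phi)),
      (k * l' + l * k') / 2 + (l * m' + m * l') * ((1 - phi) / 2),
      l * l' * phi + m * m' * (1 - phi)).
    rewrite /=; amul_expand; rewrite (amulC h a) (amulC b0 a) (amulC h b0).
    rewrite (tab_aa tab) (tab_ah tab) (tab_a0 tab) (tab_hh tab) (tab_0h tab).
    by rewrite (tab_00 tab); module_ring.
move=> x [[[k l] m] /= ->] S [[S0 SD SZ SM] Sab].
have Sa : S a by apply: Sab; left.
have Sb : S b by apply: Sab; right.
have SN y : S y -> S (- y) by rewrite -scaleN1r; apply: SZ.
have Sm : S (a ** b) := SM _ _ Sa Sb.
have Sh : S h by rewrite hE; apply: SZ (SD _ _ Sm (SN _ (SM _ _ Sa Sm))).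
have Sb0 : S b0.
  rewrite (_ : b0 = b - (phi *: a + h)); last by rewrite /b addrC addKr.
  exact: SD Sb (SN _ (SD _ _ (SZ _ _ Sa) Sh)).
exact: SD (SD _ _ (SZ _ _ Sa) (SZ _ _ Sh)) (SZ _ _ Sb0).
Qed.

Lemma ext_subspace_table phi a h b0 (b := phi *: a + h + b0) :
    peirce_table phi a h b0 -> h = 4 *: (a ** b - a ** (a ** b)) ->
  @ext_subspace F E iota A (gen_subalgebra [set a; b]) =
  [set u | exists k : E * E * E,
     u = k.1.1 *: P a + k.1.2 *: P h + k.2 *: P b0].
Proof.
move=> tab hE; rewrite /b (gen_subalgebra_table tab hE); apply/seteqP; split.
  move=> _ [s [sS ->]]; rewrite big_seq.
  pose Q (u : AE) := exists k : E * E * E,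
    u = k.1.1 *: P a + k.1.2 *: P h + k.2 *: P b0.
  apply: (big_ind Q) => [|_ _ [[[k l] m] /= ->] [[[k' l'] m'] /= ->]|p /sS].
  - by exists (0, 0, 0); rewrite /= !scale0r !addr0.
  - by exists (k + k', l + l', m + m'); rewrite /=; module_ring.
  - move=> [[[k l] m] /= ->].
    exists (p.2 * iota k, p.2 * iota l, p.2 * iota m).
    by rewrite -[p.2 in LHS]mulr1 -scale_pure !pureE /=; module_ring.
move=> _ [[[k l] m] /= ->]; exists [:: (a, k); (h, l); (b0, m)]; split.
  move=> p; rewrite !inE => /or3P[] /eqP -> /=.
  - by exists (1, 0, 0); rewrite /= scale1r !scale0r !addr0.
  - by exists (0, 1, 0); rewrite /= scale1r !scale0r add0r addr0.
  - by exists (0, 0, 1); rewrite /= scale1r !scale0r !add0r.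
by rewrite !big_cons big_nil /= !scale_pure !mulr1 addr0 addrA.
Qed.

End BaseChange.

(** * Solidity and derivations over the base field, by passage to the closure *)

Theorem theorem1p2 (F : fieldType) (A : comNAAlgType F) (X : set A)
    (charF : 2%N \notin [pchar F]) (axialX : primitive_axial_jhalf X)
    (E : closedFieldType) (iota : {rmorphism F -> E})
    (closureE : is_algebraic_closure iota)
    (a b : A) (Xa : X a) (Xb : X b) (neq_ab : a <> b) :
  solid iota a b <-> derivation (associator a b).
Proof.
have twoF : (2 : F) != 0 by apply: contra charF => two0; rewrite inE /= two0.
have twoE : (2 : E) != 0 by rewrite -(rmorph_nat iota) fmorph_eq0.
have [axa axb] := (axialX.1 _ Xa, axialX.1 _ Xb).
have [a0 aa] : nz_idempotent a by case: axa => -[].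
have [nb bb] : nz_idempotent b by case: axb => -[].
have ja : axis_identities a 1.
  by apply/(axis_identitiesP twoF); case: axa => // -[].
have jb : axis_identities b 1.
  by apply/(axis_identitiesP twoF); case: axb => // -[].
have [phi [h [b0 [tab bE hE h0phi]]]] := two_generated_table twoF axa axb
  neq_ab.
have jaE := axis_identities_pure iota ja;
  have jbE := axis_identities_pure iota jb.
have tabE := peirce_table_pure iota tab.
pose P x : scalext iota A := pure iota x 1.
have P0 x : x != 0 -> P x != 0 by apply: contra => /eqP/pure_eq0->.
have bPE : P b = iota phi *: P a + P h + P b0.
  by rewrite bE /P !pureD pureZ.
have spanE : @ext_subspace F E iota A (gen_subalgebra [set a; b]) =
    [set u | exists k : E * E * E,
       u = k.1.1 *: P a + k.1.2 *: P h + k.2 *: P b0].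
  by rewrite bE; apply: (ext_subspace_table iota tab); rewrite -bE.
(* If [h = 0], then [a ** b = 0] and both sides of the equivalence hold. *)
have [hz|h0] := eqVneq h 0.
  have phi0 := h0phi hz.
  have b0E : b0 = b by rewrite bE hz phi0 scale0r !add0r.
  have ab : a ** b = 0 by rewrite -b0E (tab_a0 tab).
  split=> _.
    split=> [|x y]; first exact: associator_is_linear.
    (* [b] is even for [a], so the Seress identity makes [L_a] and [L_b] commute. *)
    have comm z : associator a b z = 0.
      have := seress0 ja b z.
      by rewrite /seress_defect even_part_id // ab amul0r.
    by rewrite !comm amul0l amul0r addr0.
  move=> c [Bc [c0 cc] primc].
  have [[[k l] m] /= cE] : exists k : E * E * E,
      c = k.1.1 *: P a + k.1.2 *: P h + k.2 *: P b0 by move: Bc; rewrite spanE.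
  have {}cE : c = k *: P a + m *: P b.
    by rewrite cE hz b0E /P pure0 scaler0 addr0.
  have PaPb : P a ** P b = 0 by rewrite /P -pureM ab pure0.
  have free x y : x *: P a + y *: P b = 0 -> x = 0 /\ y = 0.
    move=> xy; have xa : x *: P a = 0.
      have := congr1 (amul (P a)) xy; rewrite amul0r amulDr !amulZr PaPb.
      by rewrite scaler0 addr0 /P -pureM aa.
    move: xy; rewrite xa add0r => /eqP; move/eqP: xa.
    by rewrite !scaler_eq0 (negPf (P0 _ a0)) (negPf (P0 _ nb)) !orbF => /eqP->
      /eqP.
  have [k1 m1] : k ^+ 2 - k = 0 /\ m ^+ 2 - m = 0.
    apply: free; transitivity (c ** c - c); last by rewrite cc subrr.
    rewrite cE; amul_expand; rewrite (amulC (P b) (P a)) PaPb.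
    by rewrite /P -!pureM aa bb; module_ring.
  apply/(axis_identitiesP twoE) => //.
  have idem x : x ^+ 2 - x = 0 -> x = 0 \/ x = 1 :> E.
    rewrite expr2 -{3}[x]mulr1 -mulrBr => /eqP.
    by rewrite mulf_eq0 subr_eq0 => /orP[] /eqP; [left|right].
  have [kE|kE] := idem _ k1; have [mE|mE] := idem _ m1.
  - by case/eqP: c0; rewrite cE kE mE !scale0r addr0.
  - by rewrite cE kE mE scale0r scale1r add0r.
  - by rewrite cE kE mE scale0r scale1r addr0.
  (* The remaining idempotent [P a + P b] fixes [P a] without being proportional to it, so it is not
     primitive. *)
  have [r _ rc] : line c (P a).
    rewrite -primc; split.
      by rewrite spanE; exists (1, 0, 0); rewrite /= scale1r !scale0r !addr0.
    rewrite /eigen /= scale1r cE kE mE !scale1r amulDl (amulC (P b)) PaPb.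
    by rewrite addr0 /P -pureM aa.
  have [] : r - 1 = 0 /\ r = 0.
    apply: free; transitivity (r *: c - P a); last by rewrite rc subrr.
    by rewrite cE kE mE; module_ring.
  by move=> + r0; rewrite r0 sub0r => /eqP; rewrite oppr_eq0 oner_eq0.
split=> [sol|der].
  apply/(derivation_pure iota); rewrite -/(P b) bPE.
  apply: (derivation_of_axes twoE tabE jaE) => t Nt.
  have [c0 cc] := curve_idempotent twoE tabE (P0 _ a0) (P0 _ h0) Nt.
  apply/axis_identitiesV => //; apply/(axis_identitiesP twoE) => //.
  apply: sol; split=> //; rewrite spanE.
    exists ((1 + iota phi * (1 - iota phi) * t ^+ 2)^-1,
      (1 + iota phi * (1 - iota phi) * t ^+ 2)^-1 * t,
      (1 + iota phi * (1 - iota phi) * t ^+ 2)^-1 * (t ^+ 2 * iota phi)).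
    by rewrite /= !scalerDr !scalerA.
  (* The normalized curve point is a primitive idempotent of the extended subalgebra, so solidity
     makes it an axis. *)
  apply/seteqP; split=> [_ [[[[k l] m] /= ->]]|_ [k _ <-]].
    rewrite /eigen /= scale1r => cv.
    have := curve_primitive twoE tabE (P0 _ a0) (P0 _ h0) Nt cv.
    by move=> ->; exists ((1 + iota phi * (1 - iota phi) * t ^+ 2) * k).
  split; last by rewrite /eigen /= scale1r amulZr cc.
  exists (k * (1 + iota phi * (1 - iota phi) * t ^+ 2)^-1,
    k * (1 + iota phi * (1 - iota phi) * t ^+ 2)^-1 * t,
    k * (1 + iota phi * (1 - iota phi) * t ^+ 2)^-1 * (t ^+ 2 * iota phi)).
  by rewrite /= !scalerDr !scalerA !mulrA.
move=> c [Bc idc primc].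
have [[[k l] m] /= cE] : exists k : E * E * E,
    c = k.1.1 *: P a + k.1.2 *: P h + k.2 *: P b0 by move: Bc; rewrite spanE.
rewrite cE; apply: (primitive_axis twoE tabE jaE); rewrite -?bPE -?cE //.
- by have /(derivation_pure iota) := der.
- exact: P0.
- exact: P0.
(* Since [P a] lies in the extended subalgebra, primitivity of [c] applies to it. *)
move=> ca; have [r _ rc] : line c (P a); last by exists r.
rewrite -primc; split; last by rewrite /eigen /= scale1r.
by rewrite spanE; exists (1, 0, 0); rewrite /= scale1r !scale0r !addr0.
Qed.
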